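(* Let $g\ge1$, $\Gamma\subset\mathrm{Sp}_{2g}(\mathbb Z)$ a congruence subgroup, $\mathcal A$ a finite-dimensional complex algebra, $e\in\mathbb C\setminus\{0\}$, and $A:\mathbb H_g\to\mathrm{Sym}_g(\mathbb C)$ meromorphic symmetric-matrix-valued with $$A(\gamma\cdot Z)=J(\gamma,Z)A(Z)J(\gamma,Z)^t+\frac{2e}{2\pi i}J(\gamma,Z)C^t\qquad\text{for all }\gamma=\begin{pmatrix}A_\gamma&B\\C&D\end{pmatrix}\in\Gamma.$$ For $\Phi\in\mathcal M_{k,m}(\Gamma;\mathcal A)$ define $D_A\Phi(Z)[u]:=\mathcal D_{\mathrm{raw}}(\Phi)(Z)[u]-\frac{k+m}{2e}\,(u^tA(Z)u)\,\Phi(Z)[u]$. Then $D_A\Phi\in\mathcal M_{k,m+2}(\Gamma;\mathcal A)$; equivalently, $D_A$ maps $\mathcal M_{k,m}(\Gamma;\mathcal A)$ into $\mathcal M_{k,m+2}(\Gamma;\mathcal A)$.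
   Context: $\mathbb H_g=\{Z\in\mathrm{Mat}_g(\mathbb C):Z^t=Z,\ \mathrm{Im}Z>0\}$, $\gamma\cdot Z=(A_\gamma Z+B)(CZ+D)^{-1}$, $J(\gamma,Z)=CZ+D$. $\mathrm{Sym}^m(\mathbb C^g)$ is identified with homogeneous degree-$m$ polynomials in a formal vector $u=(u_1,\dots,u_g)^t$. $\mathcal M_{k,m}(\Gamma;\mathcal A)$: meromorphic $\Phi:\mathbb H_g\to\mathrm{Sym}^m(\mathbb C^g)\otimes\mathcal A$ with $\Phi(\gamma\cdot Z)[u]=\det(J(\gamma,Z))^k\Phi(Z)[J(\gamma,Z)^tu]$ for $\gamma\in\Gamma$. $D=\frac1{2\pi i}\frac{\partial}{\partial Z}$ is the symmetric matrix of operators with diagonal entries $\frac1{2\pi i}\partial/\partial Z_{ii}$ and off-diagonal entries $\frac1{2\pi i}\cdot\frac12\partial/\partial Z_{ij}$, applied coefficientwise; $\mathcal D_{\mathrm{raw}}(\Phi)(Z)[u]:=\sum_{i,j}u_iu_j(D\Phi)_{ij}(Z)[u]$. *)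

(* Defs.v *)
From HB Require Import structures.
From mathcomp Require Import all_boot all_order all_algebra all_field.
From mathcomp Require Import all_classical all_reals all_analysis.
From mathcomp Require Import complex.
Set Implicit Arguments. Unset Strict Implicit. Unset Printing Implicit Defensive.
Import Order.TTheory GRing.Theory Num.Theory.
Import numFieldNormedType.Exports.
Local Open Scope classical_set_scope.
Local Open Scope ring_scope.

Section Siegel.
Variable R : realType.
Local Notation C := (R[i]).

Definition MC (g : nat) := ('M[C]_g : normedModType C).

Definition posdefR (g : nat) (Y : 'M[R]_g) : Prop :=
  Y^T = Y /\ forall x : 'cV[R]_g, x != 0 -> 0 < (x^T *m Y *m x) 0 0.

Definition ImM (g : nat) (Z : 'M[C]_g) : 'M[R]_g := map_mx (@complex.Im R) Z.

Definition siegel (g : nat) : set 'M[C]_g :=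
  [set Z | Z^T = Z /\ posdefR (ImM Z)].
Arguments siegel : clear implicits.

(* Parametrisation of symmetric matrices by all matrices: keep the
   upper-triangular entries (i <= j) and mirror them.  It is a continuous
   linear open surjection of 'M_g onto Sym_g(C), and the identity on Sym_g(C). *)
Definition symmx (g : nat) (X : 'M[C]_g) : 'M[C]_g :=
  \matrix_(i, j) if (i <= j)%N then X i j else X j i.

(* Preimage of H_g under symmx: an open subset of 'M_g. *)
Definition siegel_pre (g : nat) : set 'M[C]_g := (@symmx g) @^-1` siegel g.
Arguments siegel_pre : clear implicits.

(* "P Z holds for all Z in a dense open subset of H_g" (i.e. outside a
   closed nowhere-dense subset).  This is how identities between
   meromorphic functions are expressed (values at poles are junk). *)
Definition ae_siegel (g : nat) (P : 'M[C]_g -> Prop) : Prop :=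
  exists U : set (MC g),
    [/\ open U, U `<=` siegel_pre g, siegel_pre g `<=` closure U
      & forall X, U X -> P (symmx X)].

(* Meromorphic scalar function on an open set U of 'M_g (g^2 complex
   variables): locally a quotient h/q of holomorphic (= complex Frechet
   differentiable) functions, the denominator being nonzero on a dense
   subset of the neighbourhood. *)
Definition merom_on (g : nat) (U : set (MC g)) (f : MC g -> C^o) : Prop :=
  forall X0, U X0 ->
    exists V : set (MC g), exists h q : MC g -> C^o,
      [/\ open V /\ V X0, V `<=` U,
          forall X, V X -> differentiable h X /\ differentiable q X,
          V `<=` closure (V `&` [set X | q X != 0])
        & forall X, V X -> q X != 0 -> f X = h X / q X].

(* A function on H_g (given as a function on 'M_g, only its values on
   symmetric matrices matter) is meromorphic on H_g iff its composite
   with symmx is meromorphic on siegel_pre. *)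
Definition merom_siegel (g : nat) (f : 'M[C]_g -> C) : Prop :=
  merom_on (siegel_pre g : set (MC g)) (fun X : MC g => (f (symmx X) : C^o)).

Definition Abasis (A : falgType C) := vbasis (fullv : {vspace A}).
Definition Acoord (A : falgType C) (l : 'I_(\dim (fullv : {vspace A}))) (v : A) : C :=
  coord (Abasis A) l v.

Definition merom_siegel_vec (g : nat) (A : falgType C) (f : 'M[C]_g -> A) : Prop :=
  forall l, merom_siegel (fun Z => Acoord l (f Z)).

Definition merom_siegel_mx (g : nat) (f : 'M[C]_g -> 'M[C]_g) : Prop :=
  forall i j, merom_siegel (fun Z => f Z i j).

Definition Jsympl (g : nat) : 'M[int]_(g + g) :=
  block_mx 0 1%:M (- 1%:M) 0.
Arguments Jsympl : clear implicits.

Definition symplectic (g : nat) (M : 'M[int]_(g + g)) : Prop :=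
  M^T *m Jsympl g *m M = Jsympl g.

Definition cong_one (g : nat) (N : nat) (M : 'M[int]_(g + g)) : Prop :=
  forall i j, (N%:Z %| (M - 1%:M) i j)%Z.

Definition congruence_subgroup (g : nat) (G : set 'M[int]_(g + g)) : Prop :=
  [/\ forall M, G M -> symplectic M,
      G 1%:M,
      forall M N, G M -> G N -> G (M *m N),
      forall M, G M -> G (invmx M)
    & exists N : nat, (0 < N)%N /\
        forall M, symplectic M -> cong_one N M -> G M].

Definition toC (g : nat) (M : 'M[int]_g) : 'M[C]_g := map_mx (fun x : int => x%:~R) M.

Definition blkA (g : nat) (M : 'M[int]_(g + g)) : 'M[C]_g := toC (ulsubmx M).
Definition blkB (g : nat) (M : 'M[int]_(g + g)) : 'M[C]_g := toC (ursubmx M).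
Definition blkC (g : nat) (M : 'M[int]_(g + g)) : 'M[C]_g := toC (dlsubmx M).
Definition blkD (g : nat) (M : 'M[int]_(g + g)) : 'M[C]_g := toC (drsubmx M).

Definition Jfac (g : nat) (M : 'M[int]_(g + g)) (Z : 'M[C]_g) : 'M[C]_g :=
  blkC M *m Z + blkD M.

Definition sp_act (g : nat) (M : 'M[int]_(g + g)) (Z : 'M[C]_g) : 'M[C]_g :=
  (blkA M *m Z + blkB M) *m invmx (Jfac M Z).

Definition is_mono (g m : nat) (al : {ffun 'I_g -> 'I_m.+1}) : bool :=
  (\sum_i (al i : nat) == m)%N.

Definition monomial (g m : nat) (u : 'cV[C]_g) (al : {ffun 'I_g -> 'I_m.+1}) : C :=
  \prod_i (u i 0) ^+ (al i : nat).

(* Phi : H_g -> Sym^m(C^g) (x) A, represented by its values Phi Z [u] on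
   u in C^g.  Phi is a meromorphic Sym^m(C^g)(x)A-valued function iff
   there are meromorphic A-valued coefficient functions c_alpha with
   Phi Z [u] = sum_{|alpha| = m} c_alpha(Z) u^alpha (as meromorphic
   functions, i.e. on a dense open subset of H_g). *)
Definition merom_sym (g m : nat) (A : falgType C)
  (Phi : 'M[C]_g -> 'cV[C]_g -> A) : Prop :=
  exists c : {ffun 'I_g -> 'I_m.+1} -> 'M[C]_g -> A,
    (forall al, is_mono al -> merom_siegel_vec (c al)) /\
    ae_siegel (fun Z => forall u : 'cV[C]_g,
      Phi Z u = \sum_(al | is_mono al) monomial u al *: c al Z).

Definition Mkm (g : nat) (G : set 'M[int]_(g + g)) (k : int) (m : nat)
  (A : falgType C) (Phi : 'M[C]_g -> 'cV[C]_g -> A) : Prop :=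
  merom_sym m Phi /\
  forall M, G M ->
    ae_siegel (fun Z => forall u : 'cV[C]_g,
      Phi (sp_act M Z) u = (\det (Jfac M Z)) ^ k *: Phi Z ((Jfac M Z)^T *m u)).

Definition two_pi_i : C := Complex 0 (2 * pi).

Definition dder (g : nat) (A : falgType C) (f : 'M[C]_g -> A) (Z V : 'M[C]_g) : A :=
  \sum_l ('D_(V : MC g) (fun X : MC g => (Acoord l (f X) : C^o)) Z)
           *: tnth (Abasis A) l.

(* (D Phi)_{ij}: (1/2pi i) d/dZ_ii on the diagonal, (1/2pi i)(1/2) d/dZ_ij
   off the diagonal, where Z_ij = Z_ji is one variable; both are the
   derivative in the symmetric direction (E_ij + E_ji)/2. *)
Definition Dij (g : nat) (A : falgType C) (Phi : 'M[C]_g -> 'cV[C]_g -> A)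
  (i j : 'I_g) (Z : 'M[C]_g) (u : 'cV[C]_g) : A :=
  two_pi_i^-1 *: dder (fun X => Phi X u) Z
                   (2^-1 *: (delta_mx i j + delta_mx j i)).

Definition Draw (g : nat) (A : falgType C) (Phi : 'M[C]_g -> 'cV[C]_g -> A)
  (Z : 'M[C]_g) (u : 'cV[C]_g) : A :=
  \sum_i \sum_j (u i 0 * u j 0) *: Dij Phi i j Z u.

Definition DA (g : nat) (A : falgType C) (Amat : 'M[C]_g -> 'M[C]_g)
  (e : C) (k : int) (m : nat) (Phi : 'M[C]_g -> 'cV[C]_g -> A)
  (Z : 'M[C]_g) (u : 'cV[C]_g) : A :=
  Draw Phi Z u
  - ((k%:~R + m%:R) / (2 * e) * (u^T *m Amat Z *m u) 0 0) *: Phi Z u.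

End Siegel.

(* Main.v *)
Require Import Defs.
From HB Require Import structures.
From mathcomp Require Import all_boot all_order all_algebra all_field.
From mathcomp Require Import all_classical all_reals all_analysis.
From mathcomp Require Import complex.
From mathcomp Require Import perm ring lra zify.
Set Implicit Arguments. Unset Strict Implicit. Unset Printing Implicit Defensive.
Import Order.TTheory GRing.Theory Num.Theory.
Import numFieldNormedType.Exports.
Local Open Scope classical_set_scope.
Local Open Scope ring_scope.

(** Put Z' = Z + t w w^T with w = J(Z)^T u and s = u^T C w.  Then
    M.Z' = M.Z + l u u^T for l = t / (1 + t s), J(Z')^T u = (1 + t s) w and
    det J(Z') = det J(Z) (1 + t s).  Hence
    Phi(M.Z + l u u^T)[u] = det J(Z)^k (1 + t s)^(k + m) Phi(Z')[w],
    and differentiating at t = 0 shows that the raw derivative, which is the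
    derivative along u u^T, transforms with the error term (k + m) s Phi.  The
    inhomogeneous term of A cancels it, since u^T J C^T u = s.

    Meromorphy of the derivative needs that a complex differentiable function
    has complex differentiable directional derivatives.  This is proved without
    integrals: midpoint sums over dyadic subdivisions of the boundary of a square
    satisfy Goursat's theorem (bisection), which gives Cauchy's estimate
    |f'(0)| <= 4 M / rho.  Applied to f and to its differences, the estimate
    makes f' Lipschitz and f equal to its first order expansion up to a
    quadratic error, uniformly; so uniform limits of differentiable functions are
    differentiable, in particular the limit of the difference quotients. *)

(** Both laws hold only on a dense open set of [Z], and nothing places [sp_act M Z] in the set where
    the coefficients of [Phi] are differentiable. Yet differentiability at the image is needed: the
    raw derivative is a sum over pairs (i, j), and only Frechet differentiability collects it into
    one derivative along u u^T. It is extracted from the law itself. Near the image point the action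
    has an explicit local inverse, rational in the entries, and the law expresses [Phi] there
    through its coefficients near [Z]. Restricting to rank-one displacements makes the determinant
    and the vector J^T u change by the same scalar 1 + t s, so that det^k and homogeneity of degree
    m together give the weight k + m.

    In the Cauchy estimate the integral of 1/z is never evaluated. In place of 2 pi stands the lower
    bound 4: each side of a centred square contributes at least 1 to the imaginary part of the sum,
    at every level of subdivision. The constants obtained are far from sharp; what matters later is
    that they depend only on the radius and on the bound of the function. *)

Section RealNorm.
Variable R : realType.
Local Notation C := (R[i]).

(** Norms over [R[i]] are themselves elements of [R[i]]. Taking the real part loses nothing and
    moves all estimates to the ordered field [R], where [lra] applies and suprema exist. *)
Definition nr (V : normedZmodType C) (x : V) : R := complex.Re `|x|.

Lemma nrE (V : normedZmodType C) (x : V) : `|x| = (nr x)%:C%C.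
Proof. by rewrite /nr RRe_real // normr_real. Qed.

Lemma nr_ge0 (V : normedZmodType C) (x : V) : 0 <= nr x.
Proof. by rewrite -ler0c -nrE. Qed.

Lemma nr0 (V : normedZmodType C) : nr (0 : V) = 0.
Proof. by rewrite /nr normr0. Qed.

Lemma nr_eq0 (V : normedZmodType C) (x : V) : (nr x == 0) = (x == 0).
Proof.
rewrite -(normr_eq0 x) nrE -(rmorph0 (real_complex R)).
by apply/idP/idP => [/eqP ->//|/eqP[->]].
Qed.

Lemma nr_gt0 (V : normedZmodType C) (x : V) : (0 < nr x) = (x != 0).
Proof. by rewrite lt_def nr_ge0 andbT nr_eq0. Qed.

Lemma nrN (V : normedZmodType C) (x : V) : nr (- x) = nr x.
Proof. by rewrite /nr normrN. Qed.

Lemma nrD (V : normedZmodType C) (x y : V) : nr (x + y) <= nr x + nr y.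
Proof. by rewrite -lecR rmorphD /= -!nrE ler_normD. Qed.

Lemma nrB (V : normedZmodType C) (x y : V) : nr (x - y) <= nr x + nr y.
Proof. by rewrite -(nrN y) nrD. Qed.

Lemma nr_distC (V : normedZmodType C) (x y : V) : nr (x - y) = nr (y - x).
Proof. by rewrite -nrN opprB. Qed.

Lemma nrM (x y : C) : nr (x * y) = nr x * nr y.
Proof. by apply: complexI; rewrite rmorphM /= -!nrE normrM. Qed.

Lemma nrV (x : C) : nr x^-1 = (nr x)^-1.
Proof. by apply: complexI; rewrite fmorphV /= -!nrE normfV. Qed.

Lemma nrZ (V : normedModType C) (a : C) (x : V) : nr (a *: x) = nr a * nr x.
Proof. by apply: complexI; rewrite rmorphM /= -!nrE normrZ. Qed.

Lemma nrC (a : R) : nr (a%:C%C) = `|a|.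
Proof. by rewrite /nr normc_def /= expr0n addr0 sqrtr_sqr. Qed.

Lemma nrRe (x : C) : `|complex.Re x| <= nr x.
Proof. by rewrite -lecR -nrE normc_ge_Re. Qed.

Lemma nr_sqrt (x : C) : nr x = Num.sqrt (complex.Re x ^+ 2 + complex.Im x ^+ 2).
Proof. by rewrite /nr normc_def. Qed.

Lemma nrIm (x : C) : `|complex.Im x| <= nr x.
Proof.
rewrite nr_sqrt -sqrtr_sqr ler_sqrt ?addr_ge0 ?sqr_ge0 //.
by rewrite lerDr sqr_ge0.
Qed.

Lemma nr_le_ReIm (x : C) : nr x <= `|complex.Re x| + `|complex.Im x|.
Proof.
rewrite {1}[x]complexE; apply: le_trans (nrD _ _) _.
rewrite nrM !nrC lerD2l; rewrite nr_sqrt /= expr0n expr1n add0r sqrtr1 mul1r //.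
Qed.

Lemma nr_i : nr ('i%C : C) = 1.
Proof. by rewrite nr_sqrt /= expr0n expr1n add0r sqrtr1. Qed.

Lemma derivable_eps (V : normedModType C) (f : V -> C^o) (x v : V) :
  derivable f x v -> forall e : R, 0 < e -> exists2 d : R, 0 < d &
  forall h : C, nr h < d -> nr ((f (h *: v + x) : C) - f x - h * 'D_v f x) <= e * nr h.
Proof.
move=> df e e0.
have /cvgrPdist_le : (fun h : C^o => h^-1 *: (f (h *: v + x) - f x)) @ 0^' --> 'D_v f x.
  exact: df.
move=> /(_ e%:C%C); rewrite ltcR => /(_ e0) /=.
rewrite near_withinE => /nbhs_ballP[d /= d0 Hd].
have dE : d = (complex.Re d)%:C%C by rewrite RRe_real // gtr0_real.
exists (complex.Re d); first by rewrite -ltcR -dE.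
move=> h hd; have [->|h0] := eqVneq h 0.
  by rewrite scale0r add0r mul0r subr0 subrr nr0 mulr0.
have hb : ball (0 : C^o) d (h : C^o).
  by rewrite -ball_normE /ball_ /= sub0r normrN nrE dE ltcR.
have := Hd _ hb h0; rewrite nrE lecR => H.
have -> : (f (h *: v + x) : C) - f x - h * 'D_v f x
  = - (h * ('D_v f x - h^-1 * (f (h *: v + x) - f x))).
  by rewrite mulrBr mulVKf // opprB.
by rewrite nrN nrM mulrC ler_wpM2r // nr_ge0.
Qed.

End RealNorm.

(** * Goursat's theorem by discrete contour sums *)

Section Bisection.
Variable R : realType.
Local Notation C := (R[i]).
Local Notation Re := (@complex.Re R).
Local Notation Im := (@complex.Im R).
Local Notation "a %:K" := (real_complex R a) (at level 2, format "a %:K").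

Definition cell (z : C) (s : R) (x : C) : Prop :=
  (Re z <= Re x <= Re z + s) /\ (Im z <= Im x <= Im z + s).

Definition quarter (b c : bool) (z : C) (s : R) : C :=
  z + Complex (b%:R * (s / 2)) (c%:R * (s / 2)).

Lemma quarter_Re b c z s : Re (quarter b c z s) = Re z + b%:R * (s / 2).
Proof. by case: z. Qed.

Lemma quarter_Im b c z s : Im (quarter b c z s) = Im z + c%:R * (s / 2).
Proof. by case: z. Qed.

Lemma exp2V_lt (s e : R) : 0 < e -> exists n, s / 2 ^+ n < e.
Proof.
move=> e0; have [n Hn] : exists n : nat, `|s| / e < n%:R.
  by exists (Num.bound (`|s| / e)); apply: archi_boundP; rewrite divr_ge0 // ltW.
exists n; rewrite ltr_pdivrMr ?exprn_gt0 //.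
apply: (@le_lt_trans _ _ `|s|); first exact: ler_norm.
rewrite mulrC -ltr_pdivrMr //; apply: lt_trans Hn _.
by rewrite -natrX ltr_nat ltn_expl.
Qed.

(** Compactness of the square in inductive form: if [P] failed, some quarter would fail, then a
    quarter of that one, and so on; the nested squares shrink to a point, where the local hypothesis
    gives [P]. It serves both Goursat's theorem and the mean value inequality. *)
Lemma bisection (P : C -> R -> Prop) (z0 : C) (s0 : R) :
  0 < s0 ->
  (forall z s, 0 < s -> (forall b c, P (quarter b c z s) (s / 2)) -> P z s) ->
  (forall x, cell z0 s0 x -> exists2 d : R, 0 < d & forall z s, 0 < s < d ->
     cell z s x -> cell z s `<=` cell z0 s0 -> P z s) ->
  P z0 s0.
Proof.
move=> s00 Pstep Ploc; apply: contrapT => nP.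
(* A failing quarter is picked by choice; the default [zs] is never reached from a failing
   square. *)
pose next (zs : C * R) : C * R :=
  if pselect (exists bc : bool * bool, ~ P (quarter bc.1 bc.2 zs.1 zs.2) (zs.2 / 2)) is left E
  then (quarter (projT1 (cid E)).1 (projT1 (cid E)).2 zs.1 zs.2, zs.2 / 2) else zs.
have nextP zs : 0 < zs.2 -> ~ P zs.1 zs.2 ->
    exists b c, next zs = (quarter b c zs.1 zs.2, zs.2 / 2) /\ ~ P (next zs).1 (next zs).2.
  move=> zs0 nPzs; rewrite /next; case: pselect => [E|nE].
    by case: (cid E) => -[b c] /= H; exists b, c.
  exfalso; apply: nPzs; apply: Pstep => // b c; apply: contrapT => H.
  by apply: nE; exists (b, c).
pose u n := iter n next (z0, s0).
have uS n : u n.+1 = next (u n) by [].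
have uP n : (u n).2 = s0 / 2 ^+ n /\ ~ P (u n).1 (u n).2.
  elim: n => [|n [IH1 IH2]]; first by rewrite expr0 divr1.
  have [||b [c [E1 E2]]] := nextP (u n) => //.
    by rewrite IH1 divr_gt0 // exprn_gt0.
  by split=> //; rewrite uS E1 /= IH1 exprSr invfM mulrA.
have u2_gt0 n : 0 < (u n).2 by rewrite (uP n).1 divr_gt0 // exprn_gt0.
have ustep n : [/\ Re (u n).1 <= Re (u n.+1).1, Re (u n.+1).1 + (u n.+1).2 <= Re (u n).1 + (u n).2,
     Im (u n).1 <= Im (u n.+1).1 & Im (u n.+1).1 + (u n.+1).2 <= Im (u n).1 + (u n).2].
  have [||b [c [E1 E2]]] := nextP (u n) => //; first exact: (uP n).2.
  have := u2_gt0 n.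
  rewrite uS E1 /= quarter_Re quarter_Im => H.
  by case: b c {E1 E2} => -[] /=; split; lra.
have umono k n : [/\ Re (u n).1 <= Re (u (n + k)%N).1,
     Re (u (n + k)%N).1 + (u (n + k)%N).2 <= Re (u n).1 + (u n).2,
     Im (u n).1 <= Im (u (n + k)%N).1 &
     Im (u (n + k)%N).1 + (u (n + k)%N).2 <= Im (u n).1 + (u n).2].
  elim: k => [|k [I1 I2 I3 I4]]; first by rewrite addn0.
  by rewrite addnS; have [J1 J2 J3 J4] := ustep (n + k)%N; split; lra.
(* Every lower left corner stays below every upper right corner, whatever the two indices; hence the
   suprema of the lower left corners lie in all the squares. *)
have cross n k : Re (u n).1 <= Re (u k).1 + (u k).2 /\ Im (u n).1 <= Im (u k).1 + (u k).2.
  have a := u2_gt0 n; have b := u2_gt0 k.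
  case: (leqP n k) => [/subnKC <-|/ltnW /subnKC <-].
    have := umono (k - n)%N n; have := u2_gt0 (n + (k - n))%N.
    by move=> ? [? ? ? ?]; split; lra.
  have := umono (n - k)%N k; have := u2_gt0 (k + (n - k))%N.
  by move=> ? [? ? ? ?]; split; lra.
pose x : C := Complex (sup (range (fun n => Re (u n).1))) (sup (range (fun n => Im (u n).1))).
have xin n : cell (u n).1 (u n).2 x.
  split; apply/andP; split => /=.
  - apply: ub_le_sup; last by exists n.
    by exists (Re z0 + s0) => _ [k _ <-]; have [] := cross k 0%N.
  - apply: ge_sup; first by exists (Re (u 0%N).1); exists 0%N.
    by move=> _ [k _ <-]; have [] := cross k n.
  - apply: ub_le_sup; last by exists n.
    by exists (Im z0 + s0) => _ [k _ <-]; have [] := cross k 0%N.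
  - apply: ge_sup; first by exists (Im (u 0%N).1); exists 0%N.
    by move=> _ [k _ <-]; have [] := cross k n.
have [d d0 Hd] := Ploc x (xin 0%N).
have [n Hn] := exp2V_lt s0 d0.
case: (uP n) => un2; apply; apply: Hd => //.
  by rewrite u2_gt0 un2 Hn.
move=> y [/andP[y1 y2] /andP[y3 y4]].
have := umono n 0%N; rewrite add0n /= => -[I1 I2 I3 I4].
split; apply/andP; split; lra.
Qed.

(* Midpoint sum with [2 ^ j] pieces for the integral of [f] along the segment
   from [z] to [z + h]; the recursive form makes subdivision definitional. *)
Fixpoint edge (f : C -> C) (j : nat) (z h : C) : C :=
  if j is j'.+1 then edge f j' z (h / 2) + edge f j' (z + h / 2) (h / 2)
  else f (z + h / 2) * h.

Definition bdry (f : C -> C) (j : nat) (z : C) (s : R) : C :=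
  edge f j z s%:K + edge f j (z + s%:K) ('i%C * s%:K)
  - edge f j (z + 'i%C * s%:K) s%:K - edge f j z ('i%C * s%:K).

Lemma half_tE (t : R) (h z : C) : z + t%:K * (h / 2) = z + (t / 2)%:K * h.
Proof. by rewrite rmorphM fmorphV /= rmorphMn rmorph1; congr (_ + _); ring. Qed.

Lemma half_tE2 (t : R) (h z : C) :
  z + h / 2 + t%:K * (h / 2) = z + ((1 + t) / 2)%:K * h.
Proof.
rewrite rmorphM fmorphV /= rmorphMn rmorphD /= rmorph1 -addrA; congr (_ + _).
by ring.
Qed.

Lemma nr_half (h : C) : nr (h / 2) = nr h / 2.
Proof. by rewrite nrM nrV; congr (_ / _); rewrite -(rmorph_nat (real_complex R)) nrC normr_nat. Qed.

Lemma edge_bound f j z h B :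
  (forall t : R, 0 <= t <= 1 -> nr (f (z + t%:K * h)) <= B) ->
  nr (edge f j z h) <= B * nr h.
Proof.
elim: j z h => [|j IH] z h H /=.
  rewrite nrM ler_wpM2r ?nr_ge0 //.
  have := H (1 / 2); rewrite -half_tE rmorph1 (mul1r (h / 2)); apply; lra.
have E1 : nr (edge f j z (h / 2)) <= B * nr (h / 2).
  by apply: IH => t t01; rewrite half_tE; apply: H; lra.
have E2 : nr (edge f j (z + h / 2) (h / 2)) <= B * nr (h / 2).
  by apply: IH => t t01; rewrite half_tE2; apply: H; lra.
apply: le_trans (nrD _ _) _; rewrite nr_half in E1 E2; lra.
Qed.

(** Meant for 1/z: a lower bound for Im (f dz) over the whole step [h] becomes half of it on each
    half step, so it survives every subdivision. *)
Lemma edge_Im_ge f j z h c :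
  (forall t : R, 0 <= t <= 1 -> c <= Im (f (z + t%:K * h) * h)) ->
  c <= Im (edge f j z h).
Proof.
elim: j z h c => [|j IH] z h c H /=.
  have := H (1 / 2); rewrite -half_tE rmorph1 (mul1r (h / 2)); apply; lra.
have ImH (x y : C) : Im (x * (y / 2)) = Im (x * y) / 2.
  rewrite mulrA -(rmorph_nat (real_complex R)) -fmorphV; case: (x * y) => a b /=.
  by rewrite mulr0 add0r.
have E1 : c / 2 <= Im (edge f j z (h / 2)).
  apply: IH => t t01; rewrite half_tE ImH ler_pM2r ?invr_gt0 //; apply: H; lra.
have E2 : c / 2 <= Im (edge f j (z + h / 2) (h / 2)).
  apply: IH => t t01; rewrite half_tE2 ImH ler_pM2r ?invr_gt0 //; apply: H; lra.
rewrite raddfD /=; lra.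
Qed.

Lemma edgeD f g j z h : edge (fun x => f x + g x) j z h = edge f j z h + edge g j z h.
Proof. by elim: j z h => [|j IH] z h /=; rewrite ?IH ?mulrDl // addrACA. Qed.

Lemma edgeZ a f j z h : edge (fun x => a * f x) j z h = a * edge f j z h.
Proof. by elim: j z h => [|j IH] z h /=; rewrite ?IH ?mulrA // mulrDr. Qed.

(** The midpoint rule is exact on affine functions, so their sums around a closed boundary vanish at
    every level and not merely in the limit. This is the reason for choosing midpoints. *)
Lemma edge_affine a b j z h :
  edge (fun x => a + b * x) j z h = a * h + b * (z * h + h ^+ 2 / 2).
Proof. by elim: j z h => [|j IH] z h /=; rewrite ?IH; field. Qed.

Lemma bdryD f g j z s : bdry (fun x => f x + g x) j z s = bdry f j z s + bdry g j z s.
Proof. by rewrite /bdry !edgeD; ring. Qed.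

Lemma bdryZ a f j z s : bdry (fun x => a * f x) j z s = a * bdry f j z s.
Proof. by rewrite /bdry !edgeZ; ring. Qed.

Lemma bdry_affine a b j z s : bdry (fun x => a + b * x) j z s = 0.
Proof. by rewrite /bdry !edge_affine; field. Qed.

Lemma eq_edge f g j z h : f =1 g -> edge f j z h = edge g j z h.
Proof. by move=> fg; elim: j z h => [|j IH] z h /=; rewrite ?fg ?IH. Qed.

Lemma eq_bdry f g j z s : f =1 g -> bdry f j z s = bdry g j z s.
Proof. by move=> fg; rewrite /bdry !(eq_edge _ _ _ fg). Qed.

Definition frame (z : C) (s : R) (x : C) : Prop := cell z s x /\
  [\/ Re x = Re z, Re x = Re z + s, Im x = Im z | Im x = Im z + s].

Lemma frame_side z (s t : R) : 0 <= s -> 0 <= t <= 1 ->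
  [/\ frame z s (z + t%:K * s%:K), frame z s (z + s%:K + t%:K * ('i%C * s%:K)),
      frame z s (z + 'i%C * s%:K + t%:K * s%:K) & frame z s (z + t%:K * ('i%C * s%:K))].
Proof.
move=> s0 /andP[t0 t1].
have ts : 0 <= t * s <= s by rewrite mulr_ge0 //= ler_piMl.
case: z => a b; rewrite /frame /cell /=; split; split; try (split; lra).
- by apply: Or43; ring.
- by apply: Or42; ring.
- by apply: Or44; ring.
- by apply: Or41; ring.
Qed.

Lemma bdry_bound f j z s B : 0 <= s -> (forall x, frame z s x -> nr (f x) <= B) ->
  nr (bdry f j z s) <= 4 * s * B.
Proof.
move=> s0 H.
have nrs : nr (s%:K) = s by rewrite nrC ger0_norm.
have nris : nr ('i%C * s%:K) = s by rewrite nrM nr_i nrs mul1r.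
have e1 : nr (edge f j z s%:K) <= B * s.
  by rewrite -{2}nrs; apply: edge_bound => t /(frame_side z s0)[? _ _ _]; apply: H.
have e2 : nr (edge f j (z + s%:K) ('i%C * s%:K)) <= B * s.
  by rewrite -{3}nris; apply: edge_bound => t /(frame_side z s0)[_ ? _ _]; apply: H.
have e3 : nr (edge f j (z + 'i%C * s%:K) s%:K) <= B * s.
  by rewrite -{3}nrs; apply: edge_bound => t /(frame_side z s0)[_ _ ? _]; apply: H.
have e4 : nr (edge f j z ('i%C * s%:K)) <= B * s.
  by rewrite -{2}nris; apply: edge_bound => t /(frame_side z s0)[_ _ _ ?]; apply: H.
apply: le_trans (nrB _ _) _.
apply: le_trans (lerD (nrB _ _) (lexx _)) _.
apply: le_trans (lerD (lerD (nrD _ _) (lexx _)) (lexx _)) _.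
lra.
Qed.

Lemma halfK (s : R) : (s / 2)%:K = s%:K / 2.
Proof. by rewrite rmorphM fmorphV /= rmorphMn rmorph1. Qed.

Lemma quarterE b c z s :
  quarter b c z s = z + b%:R * (s%:K / 2) + c%:R * ('i%C * (s%:K / 2)).
Proof.
rewrite /quarter -addrA; congr (_ + _); rewrite -halfK.
rewrite -!(rmorph_nat (real_complex R)) /=; simpc.
by apply/eqP; rewrite eq_complex /= !eqxx.
Qed.

(** The inner edges cancel in pairs, and each outer edge at level [j.+1] is by definition two half
    edges at level [j]. The identity is exact, with the level dropping by one. *)
Lemma bdryS f j z s : bdry f j.+1 z s =
  bdry f j (quarter false false z s) (s / 2) + bdry f j (quarter true false z s) (s / 2)
  + bdry f j (quarter false true z s) (s / 2) + bdry f j (quarter true true z s) (s / 2).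
Proof.
rewrite /bdry !quarterE /= !mul0r !addr0 !mul1r !halfK.
have E1 : 'i%C * s%:K / 2 = 'i%C * (s%:K / 2) :> C by rewrite mulrA.
rewrite !E1; set h := s%:K / 2; have -> : s%:K = h + h by rewrite /h; field.
rewrite mulrDr !addrA.
rewrite (addrAC (z + h) h ('i%C * h)) (addrAC z h ('i%C * h)).
rewrite (addrAC (z + 'i%C * h) h ('i%C * h)).
ring.
Qed.

End Bisection.

Section Goursat.
Variable R : realType.
Local Notation C := (R[i]).
Local Notation Re := (@complex.Re R).
Local Notation Im := (@complex.Im R).
Local Notation "a %:K" := (real_complex R a) (at level 2, format "a %:K").

Definition has_cder (f : C -> C) (x d : C) : Prop :=
  forall e : R, 0 < e -> exists2 r : R, 0 < r & forall y : C, nr (y - x) < r ->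
    nr (f y - f x - d * (y - x)) <= e * nr (y - x).

Lemma cell_diam (z x y : C) s : cell z s x -> cell z s y -> nr (y - x) <= 2 * s.
Proof.
case: x y => [x1 x2] [y1 y2] [/= ? ?] [/= ? ?]; apply: le_trans (nr_le_ReIm _) _ => /=.
have : `|y1 - x1| <= s by rewrite ler_norml; lra.
have : `|y2 - x2| <= s by rewrite ler_norml; lra.
lra.
Qed.

(** The bound is taken proportional to the area, e' s^2, so that the bounds of four quarters add up
    to that of the square. On a small square the first order expansion of [f] contributes 0, and
    only the remainder counts. *)
Lemma goursat (f : C -> C) (z0 : C) (s0 : R) : 0 < s0 ->
  (forall x, cell z0 s0 x -> exists d, has_cder f x d) ->
  forall e, 0 < e -> exists J, forall j, (J <= j)%N -> nr (bdry f j z0 s0) <= e.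
Proof.
move=> s00 df e e0; pose e' := e / s0 ^+ 2.
have e'0 : 0 < e' by rewrite divr_gt0 // exprn_gt0.
suff [J HJ] : exists J, forall j, (J <= j)%N -> nr (bdry f j z0 s0) <= e' * s0 ^+ 2.
  exists J => j /HJ; rewrite divfK //; by rewrite expf_neq0 // gt_eqF.
pose P z s := exists J, forall j, (J <= j)%N -> nr (bdry f j z s) <= e' * s ^+ 2.
apply: (@bisection _ P) => //.
  move=> z s sgt0 IH.
  have [J1 H1] := IH false false; have [J2 H2] := IH true false.
  have [J3 H3] := IH false true; have [J4 H4] := IH true true.
  (* The successor pays for the level lost in [bdryS]. *)
  exists (J1 + J2 + J3 + J4).+1 => -[|j] // jJ; rewrite bdryS.
  have {}H1 := H1 j ltac:(clear -jJ; lia); have {}H2 := H2 j ltac:(clear -jJ; lia).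
  have {}H3 := H3 j ltac:(clear -jJ; lia); have {}H4 := H4 j ltac:(clear -jJ; lia).
  apply: le_trans (nrD _ _) _.
  apply: le_trans (lerD (nrD _ _) (lexx _)) _.
  apply: le_trans (lerD (lerD (nrD _ _) (lexx _)) (lexx _)) _.
  apply: le_trans (lerD (lerD (lerD H1 H2) H3) H4) _.
  by rewrite le_eqVlt; apply/orP; left; apply/eqP; field.
move=> x xin; have [d Hd] := df x xin.
(* The 8 is 4 for the perimeter times 2 for the diameter bound of [cell_diam]: 4 s (e'/8) (2 s) = e'
   s^2. *)
have [r r0 Hr] := Hd (e' / 8) ltac:(lra).
exists (r / 2) => [|z s /andP[s_gt0 sr] xc _]; first lra.
exists 0%N => j _.
have -> : bdry f j z s = bdry (fun y => f y - f x - d * (y - x)) j z s.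
  rewrite -[LHS]subr0 -(bdry_affine (f x - d * x) d j z s) -mulN1r -bdryZ -bdryD.
  by apply: eq_bdry => y; ring.
apply: le_trans (bdry_bound (B := e' / 8 * (2 * s)) _ (ltW s_gt0) _) _.
  move=> y [yc _]; have dm := cell_diam xc yc.
  have lt : nr (y - x) < r by apply: le_lt_trans dm _; lra.
  apply: le_trans (Hr _ lt) _; rewrite ler_wpM2l //; lra.
by rewrite le_eqVlt; apply/orP; left; apply/eqP; field.
Qed.

End Goursat.

(** * Cauchy's estimate *)

Section CauchyEstimate.
Variable R : realType.
Local Notation C := (R[i]).
Local Notation Re := (@complex.Re R).
Local Notation Im := (@complex.Im R).
Local Notation "a %:K" := (real_complex R a) (at level 2, format "a %:K").

Lemma derivable_has_cder (f : C^o -> C^o) x :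
  derivable f x 1 -> has_cder f x ('D_1 f x).
Proof.
move=> df e e0; have [r r0 Hr] := derivable_eps df e0; exists r => // y yx.
have := Hr _ yx; rewrite [X in f (X + x)](_ : _ = y - x); last exact: mulr1.
by rewrite subrK [X in nr (_ - _ - X)]mulrC.
Qed.

Lemma Im_invM (a b c d : R) :
  Im ((Complex a b)^-1 * Complex c d) = (a * d - b * c) / (a ^+ 2 + b ^+ 2).
Proof.
rewrite (_ : (Complex a b)^-1 = Complex (a / (a ^+ 2 + b ^+ 2)) (- (b / (a ^+ 2 + b ^+ 2)))) //.
by rewrite (_ : Complex _ _ * _ = Complex (a / (a ^+ 2 + b ^+ 2) * c - (- (b / (a ^+ 2 + b ^+ 2))) * d)
  (a / (a ^+ 2 + b ^+ 2) * d + (- (b / (a ^+ 2 + b ^+ 2))) * c)) //=; ring.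
Qed.

(** With side [2 * r] this gives the square of half-side [r] centred at 0. *)
Definition corner (r : R) : C := Complex (- r) (- r).

(** Replaces the residue computation. On each side Im (dz / z) equals 2 r^2 / |z|^2 for the full
    step 2 r, and |z|^2 is at most 2 r^2 there, so each of the four sides yields at least 1. *)
Lemma bdry_inv_Im j (r : R) : 0 < r -> 4 <= Im (bdry (fun z => z^-1) j (corner r) (2 * r)).
Proof.
move=> r0; have r2 : 0 < r ^+ 2 by rewrite exprn_gt0.
have bd (t : R) : 0 <= t <= 1 -> (- r + t * (2 * r)) ^+ 2 <= r ^+ 2.
  move=> /andP[t0 t1]; have : 0 <= t * (1 - t) by rewrite mulr_ge0 // subr_ge0.
  nra.
have lem (a b c d : R) : 0 < a ^+ 2 + b ^+ 2 <= a * d - b * c ->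
    1 <= Im ((Complex a b)^-1 * Complex c d).
  by case/andP=> h1 h2; rewrite Im_invM ler_pdivlMr // mul1r.
pose f z : C := z^-1.
have e1 : 1 <= Im (edge f j (corner r) (2 * r)%:K).
  apply: edge_Im_ge => t t01.
  rewrite (_ : _ + _ = Complex (- r + t * (2 * r)) (- r)); last first.
    by apply/eqP; rewrite eq_complex /=; apply/andP; split; apply/eqP; ring.
  by apply: lem; have := bd t t01; nra.
have e2 : 1 <= Im (edge f j (corner r + (2 * r)%:K) ('i%C * (2 * r)%:K)).
  apply: edge_Im_ge => t t01.
  rewrite (_ : corner r + _ + _ = Complex r (- r + t * (2 * r))); last first.
    by apply/eqP; rewrite eq_complex /=; apply/andP; split; apply/eqP; ring.
  rewrite (_ : 'i%C * _ = Complex 0 (2 * r)); last first.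
    by apply/eqP; rewrite eq_complex /=; apply/andP; split; apply/eqP; ring.
  by apply: lem; have := bd t t01; nra.
have e3 : 1 <= - Im (edge f j (corner r + 'i%C * (2 * r)%:K) (2 * r)%:K).
  rewrite -raddfN -mulN1r -edgeZ; apply: edge_Im_ge => t t01.
  rewrite mulN1r mulNr -mulrN.
  rewrite (_ : corner r + _ + _ = Complex (- r + t * (2 * r)) r); last first.
    by apply/eqP; rewrite eq_complex /=; apply/andP; split; apply/eqP; ring.
  rewrite /f (_ : - _ = Complex (- (2 * r)) 0); last first.
    by apply/eqP; rewrite eq_complex /=; apply/andP; split; apply/eqP; ring.
  by apply: lem; have := bd t t01; nra.
have e4 : 1 <= - Im (edge f j (corner r) ('i%C * (2 * r)%:K)).
  rewrite -raddfN -mulN1r -edgeZ; apply: edge_Im_ge => t t01.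
  rewrite mulN1r mulNr -mulrN.
  rewrite (_ : corner r + _ = Complex (- r) (- r + t * (2 * r))); last first.
    by apply/eqP; rewrite eq_complex /=; apply/andP; split; apply/eqP; ring.
  rewrite /f (_ : - _ = Complex 0 (- (2 * r))); last first.
    by apply/eqP; rewrite eq_complex /=; apply/andP; split; apply/eqP; ring.
  by apply: lem; have := bd t t01; nra.
rewrite /bdry !raddfB raddfD /=; rewrite -/f; lra.
Qed.

(** A quarter of the doubled square touches the centre only with its diagonally opposite
    sub-quarter, and this is the corresponding quarter of the inner square. *)
Lemma quarter_opp b c r : quarter (~~ b) (~~ c) (quarter b c (corner (2 * r)) (2 * (2 * r)))
    (2 * (2 * r) / 2) = quarter b c (corner r) (2 * r).
Proof.
by apply/eqP; rewrite eq_complex !quarter_Re !quarter_Im /=; case: b; case: c => /=;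
  apply/andP; split; apply/eqP; field.
Qed.

Lemma frame_corner r x : 0 < r -> frame (corner r) (2 * r) x -> r <= nr x <= 2 * r.
Proof.
move=> r0 [[/= xr xi] fr]; apply/andP; split.
  have a1 : - nr x <= Re x <= nr x by rewrite -ler_norml nrRe.
  have a2 : - nr x <= Im x <= nr x by rewrite -ler_norml nrIm.
  case: fr => /= E; lra.
apply: le_trans (nr_le_ReIm _) _.
have : `|Re x| <= r by rewrite ler_norml; lra.
have : `|Im x| <= r by rewrite ler_norml; lra.
lra.
Qed.

End CauchyEstimate.

Section CauchyEstimate.
Variable R : realType.
Local Notation C := (R[i]).
Local Notation Re := (@complex.Re R).
Local Notation Im := (@complex.Im R).
Local Notation "a %:K" := (real_complex R a) (at level 2, format "a %:K").

Section Estimate.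
Variables (f : C^o -> C^o) (rho M : R).
Hypothesis rho0 : 0 < rho.
Hypothesis df : forall x, cell (corner rho) (2 * rho) x -> derivable f x 1.
Hypothesis fM : forall x, cell (corner rho) (2 * rho) x -> nr (f x) <= M.
Let d : C := 'D_1 f 0.
(* Near 0 this is o(1/z), so its sums over small frames around 0 tend to 0;
   away from 0 Goursat's theorem applies, so its sum over the big frame does too. *)
Let phi (z : C) : C := ((f z : C) - f 0 - d * z) * (z^-1 * z^-1).

Let phi_cder x : cell (corner rho) (2 * rho) x -> x != 0 -> exists d, has_cder phi x d.
Proof.
move=> xc x0; exists ('D_1 (phi : C^o -> C^o) (x : C^o)); apply: derivable_has_cder.
have -> : phi = ((f \- cst (f 0)) \- (d *: (id : C^o -> C^o))) * ((fun z : C^o => z^-1) * (fun z : C^o => z^-1)).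
  by [].
have di : derivable (fun z : C^o => z^-1) (x : C^o) 1.
  by apply: (@derivableV _ _ (id : C^o -> C^o)) => //; exact: derivable_id.
apply: derivableM; last exact: derivableM.
apply: derivableB; first by apply: derivableB; [exact: df|exact: derivable_cst].
by apply: derivableZ; exact: derivable_id.
Qed.

(** An upper bound [K] for the limit superior of the boundary sums over the square of half-side
    [r]. *)
Let small r K := forall e, 0 < e -> exists J, forall j, (J <= j)%N ->
  nr (bdry phi j (corner r) (2 * r)) <= K + e.

(** The difference consists of the three sub-quarters that do not contain 0, on which [phi] is
    differentiable, so Goursat's theorem applies to each. The levels differ by one because the
    larger quarter is subdivided once more. *)
Let ring_part r b c : 0 < r -> 2 * r <= rho -> forall e, 0 < e -> exists J, forall j, (J <= j)%N ->
  nr (bdry phi j.+1 (quarter b c (corner (2 * r)) (2 * (2 * r))) (2 * (2 * r) / 2)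
      - bdry phi j (quarter b c (corner r) (2 * r)) (2 * r / 2)) <= e.
Proof.
move=> r0 rr e e0.
pose q := quarter b c (corner (2 * r)) (2 * (2 * r)).
have gou b' c' : (b' == b) || (c' == c) -> exists J, forall j, (J <= j)%N ->
    nr (bdry phi j (quarter b' c' q (2 * (2 * r) / 2)) (2 * (2 * r) / 2 / 2)) <= e / 3.
  move=> bc; apply: goursat; [lra| |lra].
  move=> x [xr xi]; move: xr xi; rewrite /q !quarter_Re !quarter_Im /= => xr xi.
  apply: phi_cder.
    split => /=; case: (b) (c) (b') (c') bc xr xi => -[] [] [] //= _; lra.
  apply/eqP => x0; move: xr xi; rewrite x0 /=.
  case: (b) (c) (b') (c') bc => -[] [] [] //= _; lra.
have [J1 H1] := gou b c ltac:(by rewrite eqxx).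
have [J2 H2] := gou b (~~ c) ltac:(by rewrite eqxx).
have [J3 H3] := gou (~~ b) c ltac:(by rewrite eqxx orbT).
exists (J1 + J2 + J3)%N => j jJ.
have {}H1 := H1 j ltac:(clear -jJ; lia); have {}H2 := H2 j ltac:(clear -jJ; lia); have {}H3 := H3 j ltac:(clear -jJ; lia).
rewrite bdryS -/q -quarter_opp -/q.
have -> : 2 * r / 2 = 2 * (2 * r) / 2 / 2 by field.
set g := fun b c => bdry phi j (quarter b c q (2 * (2 * r) / 2)) (2 * (2 * r) / 2 / 2).
rewrite -!/(g _ _) in H1 H2 H3 *.
have -> : g false false + g true false + g false true + g true true - g (~~ b) (~~ c)
   = g b c + g b (~~ c) + g (~~ b) c by case: (b); case: (c) => /=; ring.
apply: le_trans (nrD _ _) _; apply: le_trans (lerD (nrD _ _) (lexx _)) _; lra.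
Qed.

(** The ring between the two squares contributes nothing in the limit, so doubling the square does
    not change the bound [K]. *)
Let small_double r K : 0 < r -> 2 * r <= rho -> small r K -> small (2 * r) K.
Proof.
move=> r0 rr sm e e0.
have e8 : 0 < e / 8 by lra.
have [J1 H1] := ring_part false false r0 rr e8.
have [J2 H2] := ring_part true false r0 rr e8.
have [J3 H3] := ring_part false true r0 rr e8.
have [J4 H4] := ring_part true true r0 rr e8.
have [J5 H5] := sm (e / 8) e8.
exists (J1 + J2 + J3 + J4 + J5).+2 => -[|[|j]] // jJ.
have {}H1 := H1 j ltac:(clear -jJ; lia); have {}H2 := H2 j ltac:(clear -jJ; lia).
have {}H3 := H3 j ltac:(clear -jJ; lia); have {}H4 := H4 j ltac:(clear -jJ; lia).
have {}H5 := H5 j.+1 ltac:(clear -jJ; lia).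
rewrite -[bdry _ _ _ _](subrK (bdry phi j.+1 (corner r) (2 * r))).
apply: le_trans (nrD _ _) _; move: H5; set n5 := nr _ => H5.
suff : nr (bdry phi j.+2 (corner (2 * r)) (2 * (2 * r)) - bdry phi j.+1 (corner r) (2 * r)) <= 4 * (e / 8) by lra.
rewrite bdryS (bdryS phi j (corner r)).
move: H1 H2 H3 H4.
set a1 := bdry _ j.+1 _ _; set b1 := bdry _ j _ _ => H1.
set a2 := bdry _ j.+1 _ _; set b2 := bdry _ j _ _ => H2.
set a3 := bdry _ j.+1 _ _; set b3 := bdry _ j _ _ => H3.
set a4 := bdry _ j.+1 _ _; set b4 := bdry _ j _ _ => H4.
have -> : a1 + a2 + a3 + a4 - (b1 + b2 + b3 + b4) = (a1 - b1) + (a2 - b2) + (a3 - b3) + (a4 - b4) by ring.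
apply: le_trans (nrD _ _) _.
apply: le_trans (lerD (nrD _ _) (lexx _)) _.
apply: le_trans (lerD (lerD (nrD _ _) (lexx _)) (lexx _)) _; lra.
Qed.

Let in_cell x : nr x <= rho -> cell (corner rho) (2 * rho) x.
Proof.
move=> xr; have := nrRe x; have := nrIm x; rewrite !ler_norml => /andP[? ?] /andP[? ?].
by split => /=; lra.
Qed.

Let small_rho K : 0 < K -> small rho K.
Proof.
move=> K0.
have d0 : derivable f 0 1 by apply: df; apply: in_cell; rewrite nr0 ltW.
have K8 : 0 < K / 8 by lra.
have [r r0 Hr] := derivable_has_cder d0 K8.
have [n Hn] := exp2V_lt (2 * rho) r0.
suff : small (rho / 2 ^+ n) K.
  elim: (n) {Hn} => [|k IH]; first by rewrite expr0 divr1.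
  move=> sm; apply: IH.
  have E : rho / 2 ^+ k = 2 * (rho / 2 ^+ k.+1) by rewrite exprS; field; rewrite expf_neq0 ?pnatr_eq0.
  rewrite E; apply: small_double => //; first by rewrite divr_gt0 // exprn_gt0.
  rewrite -E ler_pdivrMr ?exprn_gt0 //; apply: ler_peMr; first exact: ltW.
  by apply: exprn_ege1; rewrite ler1n.
have p2 : 0 < (2 : R) ^+ n by rewrite exprn_gt0.
set s := rho / 2 ^+ n in Hn *.
have s0 : 0 < s by rewrite divr_gt0.
have {}Hn : 2 * s < r by rewrite /s mulrA.
move=> e e0; exists 0%N => j _.
suff : nr (bdry phi j (corner s) (2 * s)) <= K by lra.
(* The remainder is at most (K/8)|x|, and dividing by |x|^2 with |x| at least [s] leaves K/(8 s).
   The perimeter is 8 s, whence the 8 in [K8]. *)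
apply: le_trans (bdry_bound (B := K / 8 / s) _ _ _) _; first lra.
  move=> x /(frame_corner s0)/andP[x1 x2].
  have x0 : 0 < nr x by lra.
  have := Hr x; rewrite !subr0 => /(_ ltac:(lra)) H.
  rewrite /phi nrM; apply: le_trans (ler_wpM2r (nr_ge0 _) H) _.
  rewrite nrM nrV mulrA mulrK ?unitfE ?gt_eqF // ler_wpM2l //; first lra.
  by rewrite lef_pV2.
by rewrite le_eqVlt; apply/orP; left; apply/eqP; field; rewrite gt_eqF.
Qed.

(** Since (f z - f 0)/z^2 = phi z + d/z, the boundary sums give 4 |d| <= |sum of g| + |sum of phi|.
    The first is at most 2 M/rho^2 times the perimeter 8 rho, the second at most an arbitrary
    [K]. *)
Lemma cauchy_estimate : nr d <= 4 * M / rho.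
Proof.
suff H K : 0 < K -> 4 * nr d <= 16 * M / rho + K.
  have : 4 * nr d <= 16 * M / rho by apply/ler_addgt0Pr => K; exact: H.
  have -> : 16 * M / rho = 4 * (4 * M / rho) by ring.
  by rewrite ler_pM2l.
move=> K0; have K2 : 0 < K / 2 by lra.
have [J HJ] := small_rho K2 K2.
have {}HJ := HJ J (leqnn _).
pose g (z : C) : C := ((f z : C) - f 0) * (z^-1 * z^-1).
have gE : bdry phi J (corner rho) (2 * rho) =
    bdry g J (corner rho) (2 * rho) - d * bdry (fun z => z^-1) J (corner rho) (2 * rho).
  rewrite -mulNr -bdryZ -bdryD; apply: eq_bdry => z; rewrite /phi /g.
  (* At 0 the convention 0^-1 = 0 makes all three functions vanish, so the identity holds at every
     point. *)
  have [->|z0] := eqVneq z 0; first by rewrite invr0 !mulr0 addr0.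
  by rewrite mulrBl mulNr; congr (_ - _); rewrite mulrA mulfK.
have gB : nr (bdry g J (corner rho) (2 * rho)) <= 16 * M / rho.
  apply: le_trans (bdry_bound (B := 2 * M / rho ^+ 2) _ _ _) _.
    by rewrite mulr_ge0 // ltW.
    move=> x xf; have /andP[x1 x2] := frame_corner rho0 xf.
    have b1 := fM xf.1; have b2 := fM (in_cell (_ : nr 0 <= rho)).
    rewrite nr0 in b2; have {}b2 := b2 (ltW rho0).
    have : nr ((f x : C) - f 0) <= 2 * M.
      by apply: le_trans (nrB _ _) _; rewrite mulr2n mulrDl mul1r lerD.
    move=> b3; rewrite /g nrM ler_pM ?nr_ge0 //.
    have b4 : (nr x)^-1 <= rho^-1 by rewrite lef_pV2 // posrE (lt_le_trans rho0).
    by rewrite nrM nrV expr2 invfM ler_pM ?invr_ge0 ?nr_ge0.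
  by rewrite le_eqVlt; apply/orP; left; apply/eqP; field; rewrite gt_eqF.
have i4 : 4 <= nr (bdry (fun z : C => z^-1) J (corner rho) (2 * rho)).
  apply: le_trans (bdry_inv_Im J rho0) _.
  by apply: le_trans (nrIm _); apply: ler_norm.
have : nr d * 4 <= nr (d * bdry (fun z : C => z^-1) J (corner rho) (2 * rho)).
  by rewrite nrM ler_wpM2l // nr_ge0.
have -> : d * bdry (fun z : C => z^-1) J (corner rho) (2 * rho) =
   bdry g J (corner rho) (2 * rho) - bdry phi J (corner rho) (2 * rho) by rewrite gE; ring.
move=> h; have := le_trans h (nrB _ _); lra.
Qed.

End Estimate.

End CauchyEstimate.

(** * Holomorphic functions on normed spaces *)

Section FrechetHolomorphy.
Variable R : realType.
Local Notation C := (R[i]).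
Local Notation Re := (@complex.Re R).
Local Notation Im := (@complex.Im R).
Local Notation "a %:K" := (real_complex R a) (at level 2, format "a %:K").

Lemma near_nr (V : normedModType C) (P : set V) (x : V) :
  nbhs x P <-> exists2 r : R, 0 < r & forall y, nr (y - x) < r -> P y.
Proof.
split.
  move=> /nbhs_ballP[e /= e0 He].
  have eE : e = (Re e)%:K by rewrite RRe_real // gtr0_real.
  exists (Re e); first by rewrite -ltcR -eE.
  move=> y yx; apply: He; rewrite -ball_normE /ball_ /= distrC nrE eE ltcR //.
move=> [r r0 Hr]; apply/nbhs_ballP; exists r%:K; first by rewrite /= ltcR.
by move=> y; rewrite -ball_normE /ball_ /= distrC nrE ltcR => /Hr.
Qed.

(** Bisection again, applied to the bottom edges of squares. The slack [e] absorbs the local first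
    order error. *)
Lemma real_mean_value_bound (F : C^o -> C^o) (K : R) :
  (forall t : R, 0 <= t <= 1 -> derivable F (t%:K : C^o) 1 /\ nr ('D_1 F (t%:K : C^o)) <= K) ->
  nr (F 1 - F 0) <= K.
Proof.
move=> H; apply/ler_addgt0Pr => e e0.
(* The premise makes [P] vacuous off the real axis, where nothing is known about [F]; only the two
   lower quarters enter the inductive step. *)
pose P z s := Im z = 0 -> nr ((F (z + s%:K) : C) - F z) <= (K + e) * s.
suff : P 0 1 by move=> /(_ erefl); rewrite add0r rmorph1 mulr1.
apply: (@bisection _ P) => //.
  move=> z s s0 IH z0.
  have := IH false false; have := IH true false; rewrite /P !quarter_Im mul0r addr0.
  move=> /(_ z0) H1 /(_ z0) H2; move: H1 H2.
  rewrite !quarterE !mul0r !addr0 mul1r halfK -addrA.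
  rewrite (_ : s%:K / 2 + s%:K / 2 = s%:K); last by field.
  move=> H1 H2.
  rewrite -(subrK (F (z + s%:K / 2)) (F (z + s%:K))) -addrA.
  apply: le_trans (nrD _ _) _; apply: le_trans (lerD H1 H2) _; lra.
move=> x [xr xi]; have [x0|xn0] := eqVneq (Im x) 0; last first.
  exists `|Im x|; first by rewrite normr_gt0.
  move=> z s /andP[s0 sx] [_ /andP[z1 z2]] _ z0.
  by exfalso; move: sx; rewrite ger0_norm ?z0 in z1 z2 *; lra.
have xE : x = (Re x)%:K by case: x x0 {xr xi} => a b /= ->.
have [dF FK] := H (Re x) ltac:(move: xr => /=; lra).
rewrite -xE in dF FK.
have [r r0 Hr] := derivable_has_cder dF e0.
exists r => // z s /andP[s0 sr] [zx _] _ z0.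
have zE : z = (Re z)%:K by case: z z0 {zx} => a b /= ->.
have n1 : nr (z + s%:K - x) = Re z + s - Re x.
  by rewrite zE xE -rmorphD -rmorphB /= nrC ger0_norm; lra.
have n2 : nr (z - x) = Re x - Re z.
  by rewrite zE xE -rmorphB /= nrC distrC ger0_norm; lra.
have h1 := Hr (z + s%:K) ltac:(rewrite n1; lra).
have h2 := Hr z ltac:(rewrite n2; lra).
rewrite n1 in h1; rewrite n2 in h2.
(* Because x lies between z and z + s, the errors e (z + s - x) and e (x - z) add up to exactly e
   s. *)
have -> : (F (z + s%:K) : C) - F z = (F (z + s%:K) - F x - 'D_1 F x * (z + s%:K - x))
   - (F z - F x - 'D_1 F x * (z - x)) + 'D_1 F x * s%:K.
  rewrite (_ : 'D_1 F x * s%:K = 'D_1 F x * (z + s%:K - x) - 'D_1 F x * (z - x)); last by ring.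
  by ring.
apply: le_trans (nrD _ _) _; apply: le_trans (lerD (nrB _ _) (lexx _)) _.
have h3 : nr ('D_1 F x * s%:K) <= K * s.
  by rewrite nrM nrC (ger0_norm (ltW s0)) ler_wpM2r // ltW.
lra.
Qed.

Section Line.
Variables (E : normedModType C).
Implicit Types (f : E -> C^o) (X Y w : E).

Lemma derive_line f Y w (a : C^o) :
  'D_1 (fun l : C^o => f (Y + l *: w)) a = 'D_w f (Y + a *: w).
Proof.
rewrite /derive; set g := fun _ => _; set h := fun _ => _.
suff -> : g = h by [].
apply/funext => l; rewrite /g /h /= -[(l *: 1 : C^o)]/(l * 1) mulr1.
by rewrite scalerDl addrCA.
Qed.

Lemma derivable_line f Y w (a : C^o) : derivable f (Y + a *: w) w ->
  derivable (fun l : C^o => f (Y + l *: w)) a 1.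
Proof.
rewrite /derivable; set g := fun _ => _; set h := fun _ => _.
suff -> : h = g by [].
apply/funext => l; rewrite /g /h /= -[(l *: 1 : C^o)]/(l * 1) mulr1.
by rewrite scalerDl addrCA.
Qed.

Definition holo_bounded f X (r M : R) :=
  forall Y, nr (Y - X) < r -> differentiable f Y /\ nr (f Y) <= M.

Lemma frechet_cauchy f X r M : 0 < r -> holo_bounded f X r M ->
  forall w, nr ('d f X w) <= 16 * M / r * nr w.
Proof.
move=> r0 H w; have [->|w0] := eqVneq w 0.
  by rewrite linear0 !nr0 mulr0.
have nw : 0 < nr w by rewrite nr_gt0.
(* On the square of half-side [rho] the parameter satisfies |l| <= 2 rho, so |l w| <= r/2 keeps the
   line inside the ball. *)
pose rho := r / (4 * nr w).
have rho0 : 0 < rho by rewrite divr_gt0 // mulr_gt0.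
have inb (l : C) : cell (corner rho) (2 * rho) l -> nr (X + l *: w - X) < r.
  move=> [/= l1 l2]; rewrite addrC addKr nrZ.
  have : nr l <= 2 * rho.
    apply: le_trans (nr_le_ReIm _) _.
    have : `|Re l| <= rho by rewrite ler_norml; lra.
    have : `|Im l| <= rho by rewrite ler_norml; lra.
    lra.
  move=> hl; apply: le_lt_trans (ler_wpM2r (ltW nw) hl) _.
  rewrite /rho (_ : 2 * (r / (4 * nr w)) * nr w = r / 2); last by field; rewrite gt_eqF.
  lra.
have HX : differentiable f X by have [] := H X ltac:(by rewrite subrr nr0).
have d1 x : cell (corner rho) (2 * rho) x -> derivable (fun l : C^o => f (X + l *: w)) x 1.
  by move=> /inb /H [df _]; apply: derivable_line; exact: diff_derivable.
have b1 x : cell (corner rho) (2 * rho) x -> nr (f (X + x *: w)) <= M.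
  by move=> /inb /H [].
have := cauchy_estimate rho0 d1 b1.
rewrite derive_line scale0r addr0 deriveE //.
rewrite (_ : 4 * M / rho = 16 * M / r * nr w) //.
by rewrite /rho; field; rewrite !gt_eqF.
Qed.

Lemma holo_bounded_sub f X Y r r' M : holo_bounded f X r M ->
  nr (Y - X) + r' <= r -> holo_bounded f Y r' M.
Proof.
move=> H h Z hZ; apply: H; rewrite -(subrK Y Z) -addrA.
by apply: le_lt_trans (nrD _ _) _; lra.
Qed.

(** The function l -> f (Y + l w) - c l has derivative 'd f w - c along the segment. The case c = 0
    gives the Lipschitz bound, and c = 'd f X w the first order expansion. *)
Lemma mean_value_bound f Y w (c : C) K :
  (forall t : R, 0 <= t <= 1 -> differentiable f (Y + t%:K *: w) /\
    nr ('d f (Y + t%:K *: w) w - c) <= K) ->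
  nr (f (Y + w) - f Y - c) <= K.
Proof.
move=> H.
pose F (l : C^o) : C^o := f (Y + l *: w) - c *: l.
have -> : f (Y + w) - f Y - c = F 1 - F 0.
  rewrite /F scale1r scale0r addr0 -![_ *: (_ : C^o)]/(_ * _) mulr1 mulr0 subr0.
  by rewrite addrAC.
apply: real_mean_value_bound => t /H [df K1].
have D1 : derivable (fun l : C^o => f (Y + l *: w)) (t%:K : C^o) 1.
  by apply: derivable_line; exact: diff_derivable.
have D2 : derivable (c *: (id : C^o -> C^o)) (t%:K : C^o) 1.
  by apply: derivableZ; exact: derivable_id.
have FE : F = (fun l : C^o => f (Y + l *: w)) - c *: (id : C^o -> C^o) by [].
split; first by rewrite FE; exact: derivableB.
rewrite FE deriveB // derive_line deriveZ; last exact: derivable_id.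
by rewrite derive_id deriveE // -[_ *: (_ : C^o)]/(_ * _) mulr1.
Qed.

(** Each point of the segment is the centre of a ball of radius r/2 inside the given one; the Cauchy
    bound for that radius is 32 M/r. *)
Lemma frechet_lipschitz f X r M Y Y' : 0 < r -> holo_bounded f X r M ->
  nr (Y - X) < r / 2 -> nr (Y' - X) < r / 2 ->
  nr (f Y' - f Y) <= 32 * M / r * nr (Y' - Y).
Proof.
move=> r0 H hY hY'.
have -> : f Y' - f Y = f (Y + (Y' - Y)) - f Y - 0 by rewrite subr0 [Y + _]addrC subrK.
apply: mean_value_bound => t t01; rewrite subr0.
have ht : nr (Y + t%:K *: (Y' - Y) - X) < r / 2.
  have -> : Y + t%:K *: (Y' - Y) - X = (1 - t)%:K *: (Y - X) + t%:K *: (Y' - X).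
    rewrite rmorphB rmorph1 scalerBl scale1r -[RHS]addrA [X in _ = _ + X]addrC -scalerBr.
    by rewrite opprB addrA subrK addrAC.
  have /andP[t0 t1] := t01.
  apply: le_lt_trans (nrD _ _) _; rewrite !nrZ !nrC (ger0_norm t0) ger0_norm ?subr_ge0 //.
  set c := Num.max (nr (Y - X)) (nr (Y' - X)).
  have : (1 - t) * nr (Y - X) <= (1 - t) * c by rewrite ler_wpM2l ?subr_ge0 // le_max lexx.
  have : t * nr (Y' - X) <= t * c by rewrite ler_wpM2l // le_max lexx orbT.
  have : c < r / 2 by rewrite gt_max hY hY'.
  lra.
have [d _] : differentiable f (Y + t%:K *: (Y' - Y)) /\ nr (f (Y + t%:K *: (Y' - Y))) <= M.
  by apply: H; lra.
split=> //.
have H2 : holo_bounded f (Y + t%:K *: (Y' - Y)) (r / 2) M.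
  by apply: holo_bounded_sub H _; lra.
have := frechet_cauchy (_ : 0 < r / 2) H2 (Y' - Y).
rewrite (_ : 16 * M / (r / 2) = 32 * M / r); last by field; rewrite gt_eqF.
by apply; lra.
Qed.

(* Cauchy's estimate for [Z |-> f (Z + (Y - X)) - f Z], whose size is
   controlled by the Lipschitz bound on [f] *)
Lemma diff_lipschitz f X r M Y w : 0 < r -> holo_bounded f X r M -> nr (Y - X) < r / 4 ->
  nr ('d f Y w - 'd f X w) <= 2048 * M / r ^+ 2 * nr (Y - X) * nr w.
Proof.
move=> r0 H hY.
have HX : differentiable f X by have [] := H X ltac:(by rewrite subrr nr0).
have HY : differentiable f Y by have [] := H Y ltac:(lra).
pose g Z : C^o := f (Z + (Y - X)) - f Z.
have gd Z : nr (Z - X) < r / 4 -> differentiable g Z /\ 'd g Z w = 'd f (Z + (Y - X)) w - 'd f Z w.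
  move=> hZ.
  have hZ' : nr (Z + (Y - X) - X) < r.
    rewrite addrAC; apply: le_lt_trans (nrD _ _) _; lra.
  have d1 : differentiable f Z by have [] := H Z ltac:(lra).
  have d2 : differentiable f (Z + (Y - X)) by have [] := H _ hZ'.
  have d3 : differentiable (fun Z => Z + (Y - X)) Z.
    by apply: (@differentiableD _ _ _ (id : E -> E)) => //; exact: differentiable_cst.
  have d4 : differentiable (f \o (fun Z => Z + (Y - X))) Z by exact: differentiable_comp.
  have dg : differentiable g Z by exact: differentiableB.
  split=> //; apply: etrans (esym (deriveE w dg)) _.
  apply: etrans _ (congr2 (fun a b => a - b) (deriveE w d2) (deriveE w d1)).
  have -> : 'D_w f (Z + (Y - X)) = 'D_w (f \o (fun Z => Z + (Y - X))) Z.
    rewrite /derive; set k := fun _ => _; set h := fun _ => _.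
    by suff -> : k = h by []; apply/funext => l; rewrite /k /h /= addrA.
  by apply: deriveB; apply: diff_derivable.
have Hg : holo_bounded g X (r / 4) (32 * M / r * nr (Y - X)).
  move=> Z hZ; split; first by case: (gd Z hZ).
  have E1 : nr (Y - X) = nr (Z + (Y - X) - Z) by rewrite [Z + _]addrC addrK.
  rewrite E1; apply: (frechet_lipschitz r0 H); first by move: hZ r0; set a := nr _; lra.
  rewrite addrAC; apply: le_lt_trans (nrD _ _) _; lra.
have r4 : 0 < r / 4 by lra.
have hX : nr (X - X) < r / 4 by rewrite subrr nr0.
have gX : 'd f Y w - 'd f X w = 'd g X w.
  apply: etrans _ (esym (gd X hX).2).
  by rewrite [X + _]addrC subrK.
apply: le_trans (_ : nr ('d g X w : C^o) <= _).
  by rewrite le_eqVlt; apply/orP; left; apply/eqP; exact: (congr1 (@nr R C^o) gX).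
apply: le_trans (frechet_cauchy r4 Hg w) _.
rewrite (_ : 16 * (32 * M / r * nr (Y - X)) / (r / 4) = 2048 * M / r ^+ 2 * nr (Y - X)) //.
by field; rewrite gt_eqF.
Qed.

(** A quadratic remainder without a second derivative: along the segment 'd f stays within a
    multiple of |w| of its value at [X], by [diff_lipschitz]. *)
Lemma taylor1_bound f X r M w : 0 < r -> holo_bounded f X r M -> nr w < r / 4 ->
  nr (f (X + w) - f X - 'd f X w) <= 2048 * M / r ^+ 2 * nr w ^+ 2.
Proof.
move=> r0 H hw; have M0 : 0 <= M.
  by have [_] := H X ltac:(by rewrite subrr nr0); apply: le_trans; exact: nr_ge0.
apply: mean_value_bound => t /andP[t0 t1].
have ht : nr (X + t%:K *: w - X) <= nr w.
  by rewrite [X + _]addrC addrK nrZ nrC ger0_norm // ler_piMl // nr_ge0.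
split; first by have [] := H (X + t%:K *: w) ltac:(lra).
apply: le_trans (diff_lipschitz w r0 H _) _; first lra.
rewrite -mulrA; apply: ler_wpM2l.
  exact: (divr_ge0 (mulr_ge0 (ler0n _ _) M0) (exprn_ge0 _ (ltW r0))).
by rewrite expr2; apply: ler_wpM2r; [exact: nr_ge0 | exact: ht].
Qed.

End Line.
End FrechetHolomorphy.

(** * Uniform limits of holomorphic functions, and holomorphy of directional derivatives *)

Section UniformLimits.
Variable R : realType.
Local Notation C := (R[i]).
Local Notation Re := (@complex.Re R).
Local Notation Im := (@complex.Im R).
Local Notation "a %:K" := (real_complex R a) (at level 2, format "a %:K").

Lemma real_cauchy_lim (u : nat -> R) :
  (forall e : R, 0 < e -> exists N, forall n m, (N <= n)%N -> (N <= m)%N -> `|u n - u m| <= e) ->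
  exists l, forall e : R, 0 < e -> exists N, forall n, (N <= n)%N -> `|u n - l| <= e.
Proof.
move=> H; have : cvg (u @ \oo).
  apply: cauchy_cvg; apply: cauchy_exP => e e0.
  have [N HN] := H (e / 2) ltac:(lra); exists (u N).
  exists N => // n /= Nn; rewrite /ball /=.
  by apply: le_lt_trans (HN N n _ _) _ => //; lra.
move=> /cvgrPdist_le Hl; exists (lim (u @ \oo)) => e /Hl [N _ HN].
by exists N => n Nn; rewrite distrC; apply: HN.
Qed.

Lemma complex_cauchy_lim (u : nat -> C) :
  (forall e : R, 0 < e -> exists N, forall n m, (N <= n)%N -> (N <= m)%N -> nr (u n - u m) <= e) ->
  exists l, forall e : R, 0 < e -> exists N, forall n, (N <= n)%N -> nr (u n - l) <= e.
Proof.
move=> H.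
have [a Ha] : exists l, forall e : R, 0 < e -> exists N, forall n, (N <= n)%N -> `|Re (u n) - l| <= e.
  apply: real_cauchy_lim => e /H[N HN]; exists N => n m Nn Nm.
  by rewrite -raddfB; apply: le_trans (nrRe _) (HN _ _ Nn Nm).
have [b Hb] : exists l, forall e : R, 0 < e -> exists N, forall n, (N <= n)%N -> `|Im (u n) - l| <= e.
  apply: real_cauchy_lim => e /H[N HN]; exists N => n m Nn Nm.
  by rewrite -raddfB; apply: le_trans (nrIm _) (HN _ _ Nn Nm).
exists (Complex a b) => e e0; have e2 : 0 < e / 2 by lra.
have [N1 H1] := Ha _ e2; have [N2 H2] := Hb _ e2; exists (N1 + N2)%N => n Nn.
apply: le_trans (nr_le_ReIm _) _; rewrite !raddfB /=.
have := H1 n ltac:(lia); have := H2 n ltac:(lia); lra.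
Qed.

Section Weierstrass.
Variables (E : normedModType C).
Implicit Types (X Y w : E).

Lemma differentiable_of_bound (f : E -> C^o) X (L : {linear E -> C^o}) (K r : R) : 0 < r ->
  (forall w, nr (L w) <= K * nr w) ->
  (forall w, nr w < r -> nr (f (X + w) - f X - L w) <= K * nr w ^+ 2) ->
  differentiable f X.
Proof.
move=> r0 LK H.
have K1 : 0 < `|K| + 1 by rewrite ltr_wpDl.
have KK : K <= `|K| + 1 by apply: le_trans (ler_norm _) _; rewrite lerDl.
have Lc : continuous L.
  move=> Y; apply/cvgrPdist_le => e e0.
  have eE : e = (Re e)%:K by rewrite RRe_real // gtr0_real.
  have e0' : 0 < Re e by rewrite -ltcR -eE.
  apply/near_nr; exists (Re e / (`|K| + 1)); first by rewrite divr_gt0.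
  move=> Z ZY; rewrite -linearB nrE eE lecR.
  apply: le_trans (LK _) _; rewrite nr_distC.
  apply: le_trans (ler_wpM2r (nr_ge0 _) KK) _.
  by rewrite mulrC -ler_pdivlMr // ltW.
have fo : f \o shift X = cst (f X) + L +o_ (0 : E) id.
  apply/eqaddoP => e e0.
  have eE : e = (Re e)%:K by rewrite RRe_real // gtr0_real.
  have e0' : 0 < Re e by rewrite -ltcR -eE.
  apply/near_nr; exists (Num.min r (Re e / (`|K| + 1))).
    by rewrite lt_min r0 divr_gt0.
  move=> w; rewrite subr0 lt_min => /andP[w1 w2].
  rewrite !nrE {1}eE -rmorphM lecR /=.
  have -> : (f \o shift X - (cst (f X) + L)) w = f (X + w) - f X - L w.
    by rewrite -[LHS]/(f (w + X) - (f X + L w)) opprD addrA [w + X]addrC.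
  apply: le_trans (H _ w1) _; rewrite expr2 mulrA ler_wpM2r ?nr_ge0 //.
  apply: le_trans (ler_wpM2r (nr_ge0 _) KK) _.
  by rewrite mulrC -ler_pdivlMr // ltW.
apply/diff_locallyP.
by rewrite (diff_unique Lc fo).
Qed.

Lemma leq_add3 (a b c : nat) : [/\ a <= a + b + c, b <= a + b + c & c <= a + b + c]%N.
Proof. by split; lia. Qed.

(** Supplies the candidate for the derivative of a limit. Its continuity is not claimed here; it
    comes later from a bound that is uniform in [n]. *)
Lemma linear_pointwise_limit (d : nat -> {linear E -> C^o}) :
  (forall w (e : R), 0 < e -> exists N, forall n m, (N <= n)%N -> (N <= m)%N ->
     nr (d n w - d m w) <= e) ->
  exists L : {linear E -> C^o}, forall w (e : R), 0 < e ->
    exists N, forall n, (N <= n)%N -> nr (d n w - L w) <= e.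
Proof.
move=> cau.
pose L w : C^o := projT1 (cid (complex_cauchy_lim (cau w))).
have LP w e : 0 < e -> exists N, forall n, (N <= n)%N -> nr (d n w - L w) <= e.
  exact: (projT2 (cid (complex_cauchy_lim (cau w)))).
have L_lin : linear L.
  move: (L) LP => {cau}L LP a v w.
  apply/eqP; rewrite -subr_eq0 -nr_eq0 eq_le nr_ge0 andbT.
  apply/ler_addgt0Pr => e e0; rewrite add0r.
  have e3 : 0 < e / 3 by rewrite divr_gt0.
  have a1 : 0 < nr a + 1 by rewrite ltr_wpDl // nr_ge0.
  have e4 : 0 < e / (3 * (nr a + 1)) by rewrite divr_gt0 // mulr_gt0.
  have [N1 H1] := LP (a *: v + w) _ e3; have [N2 H2] := LP v _ e4; have [N3 H3] := LP w _ e3.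
  have [n1 n2 n3] := leq_add3 N1 N2 N3; move: (N1 + N2 + N3)%N n1 n2 n3 => n n1 n2 n3.
  have {}H1 := H1 n n1; have {}H2 := H2 n n2; have {}H3 := H3 n n3.
  rewrite linearD linearZ in H1.
  have -> : L (a *: v + w) - (a *: L v + L w) =
     - ((a *: d n v + d n w) - L (a *: v + w)) + a *: (d n v - L v) + (d n w - L w).
    by rewrite scalerBr -![_ *: (_ : C^o)]/(_ * _); ring.
  apply: le_trans (nrD _ _) _; apply: le_trans (lerD (nrD _ _) (lexx _)) _.
  rewrite nrN nrZ.
  have H4 : nr a * nr (d n v - L v) <= e / 3.
    apply: le_trans (ler_wpM2l (nr_ge0 _) H2) _.
    rewrite mulrA ler_pdivrMr ?mulr_gt0 //.
    rewrite (_ : e / 3 * (3 * (nr a + 1)) = nr a * e + e); last by field.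
    by rewrite lerDl ltW.
  apply: le_trans (lerD (lerD H1 H4) H3) _.
  by rewrite le_eqVlt; apply/orP; left; apply/eqP; field.
pose Lm := GRing.isLinear.Build _ _ _ _ L L_lin.
by exists (HB.pack_for {linear E -> C^o} L Lm).
Qed.

(** The differentials at [X] form a Cauchy sequence by the Cauchy estimate for [u n - u m]. The
    bounds of [frechet_cauchy] and [taylor1_bound] depend only on [r] and [M], so both pass to the
    limit. *)
Lemma differentiable_uniform_limit (u : nat -> E -> C^o) (f : E -> C^o) X (r M : R) :
  0 < r -> (forall n, holo_bounded (u n) X r M) ->
  (forall e : R, 0 < e -> exists N, forall n, (N <= n)%N -> forall Y, nr (Y - X) < r ->
     nr (u n Y - f Y) <= e) ->
  differentiable f X.
Proof.
move=> r0 Hu Hf.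
have hX : nr (X - X) < r by rewrite subrr nr0.
have M0 : 0 <= M by have [_] := Hu 0%N X hX; apply: le_trans; exact: nr_ge0.
have duX n : differentiable (u n) X by have [] := Hu n X hX.
have [|L LP] := @linear_pointwise_limit (fun n => 'd (u n) X).
  move=> w e e0.
  have w1 : 0 < nr w + 1 by rewrite ltr_wpDl // nr_ge0.
  (* Chosen so that the Cauchy bound 16 (2 e1)/r |w| becomes e |w|/(|w| + 1), which is at most e
     even for w = 0. *)
  have e10 : 0 < e * r / (32 * (nr w + 1)) by rewrite divr_gt0 ?mulr_gt0.
  have [N HN] := Hf _ e10; exists N => n m Nn Nm.
  set e1 := e * r / _ in e10 HN.
  have H2 : holo_bounded (u n - u m) X r (e1 + e1).
    move=> Y hY; have [dn _] := Hu n Y hY; have [dm _] := Hu m Y hY.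
    split; first exact: differentiableB.
    rewrite -[(u n - u m) Y]/(u n Y - u m Y) -[u n Y](subrK (f Y)) -addrA.
    apply: le_trans (nrD _ _) _; rewrite lerD ?HN //.
    by rewrite nr_distC HN.
  have dE : 'd (u n) X w - 'd (u m) X w = 'd (u n - u m) X w.
    have dd : differentiable (u n - u m) X by exact: differentiableB.
    apply: etrans _ (deriveE w dd).
    apply: etrans (esym (congr2 (fun a b => a - b) (deriveE w (duX n)) (deriveE w (duX m)))) _.
    by apply/esym/deriveB; apply: diff_derivable.
  apply: le_trans (_ : nr ('d (u n - u m) X w : C^o) <= _).
    by rewrite le_eqVlt; apply/orP; left; apply/eqP; exact: (congr1 (@nr R C^o) dE).
  apply: le_trans (frechet_cauchy r0 H2 w) _; rewrite /e1.
  rewrite (_ : 16 * (e * r / (32 * (nr w + 1)) + e * r / (32 * (nr w + 1))) / r * nr w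
      = e * (nr w / (nr w + 1))); last by field; rewrite !gt_eqF.
  by rewrite ler_piMr ?(ltW e0) // ler_pdivrMr // mul1r lerDl.
pose K := 16 * M / r + 2048 * M / r ^+ 2.
have K1 : 0 <= 16 * M / r := divr_ge0 (mulr_ge0 (ler0n _ _) M0) (ltW r0).
have K2 : 0 <= 2048 * M / r ^+ 2 :=
  divr_ge0 (mulr_ge0 (ler0n _ _) M0) (exprn_ge0 _ (ltW r0)).
apply: (@differentiable_of_bound f X L K (r / 4)); first by rewrite divr_gt0.
  move=> w; apply/ler_addgt0Pr => e e0.
  have [N HN] := LP w _ e0.
  rewrite -[L w](subrK ('d (u N) X w)) addrC.
  apply: le_trans (nrD _ _) _; apply: lerD; last by rewrite nr_distC HN.
  apply: le_trans (frechet_cauchy r0 (Hu N) w) _.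
  by rewrite ler_wpM2r ?nr_ge0 // lerDl.
move=> w wr; apply/ler_addgt0Pr => e e0.
have e3 : 0 < e / 3 by rewrite divr_gt0.
have [N1 H1] := LP w _ e3; have [N2 H2] := Hf _ e3.
have n1 := leq_addr N2 N1; have n2 := leq_addl N1 N2.
move: (N1 + N2)%N n1 n2 => n n1 n2.
have {}H1 := H1 n n1; have h1 := H2 n n2 X hX.
have h2 : nr (u n (X + w) - f (X + w)) <= e / 3.
  apply: (H2 n n2); rewrite [X + w]addrC addrK; apply: lt_trans wr _.
  by rewrite ltr_pdivrMr // ltr_pMr // ltr1n.
have h3 := taylor1_bound r0 (Hu n) wr.
have -> : f (X + w) - f X - L w = (u n (X + w) - u n X - 'd (u n) X w)
   - (u n (X + w) - f (X + w)) + (u n X - f X) + ('d (u n) X w - L w).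
  move: ('d (u n) X w : C^o) (L w) (f X) (f (X + w)) (u n X) (u n (X + w)).
  by clear; move=> a b c d e f; ring.
apply: le_trans (nrD _ _) _.
apply: le_trans (lerD (nrD _ _) (lexx _)) _.
apply: le_trans (lerD (lerD (nrB _ _) (lexx _)) (lexx _)) _.
apply: le_trans (lerD (lerD (lerD h3 h2) h1) H1) _.
have : 2048 * M / r ^+ 2 * nr w ^+ 2 <= K * nr w ^+ 2.
  by rewrite ler_wpM2r ?exprn_ge0 ?nr_ge0 // lerDr.
move: (_ * nr w ^+ 2) (K * _); clear; move=> a b; lra.
Qed.

Lemma locally_holo_bounded (f : E -> C^o) X : (\forall Y \near X, differentiable f Y) ->
  exists r M : R, 0 < r /\ holo_bounded f X r M.
Proof.
move=> Hd; have fc : {for X, continuous f}.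
  by apply: differentiable_continuous; exact: nbhs_singleton Hd.
have : \forall Y \near X, differentiable f Y /\ nr (f Y) <= nr (f X) + 1.
  near=> Y; split; first by near: Y.
  have : nr (f Y - f X) <= 1.
    by rewrite nr_distC -lecR -nrE; near: Y; move/cvgrPdist_le : fc; apply; rewrite ltcR.
  move=> h; rewrite -[f Y](subrK (f X)); apply: le_trans (nrD _ _) _; lra.
move=> /near_nr[r r0 Hr]; exists r, (nr (f X) + 1); split=> //.
Unshelve. all: by end_near.
Qed.

(** The difference quotients with step 1/s n are differentiable, and [taylor1_bound] shows that they
    converge to the derivative uniformly, at rate 1/s n. *)
Lemma differentiable_derive (f : E -> C^o) X v : (\forall Y \near X, differentiable f Y) ->
  differentiable (fun Y => 'D_v f Y : C^o) X.
Proof.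
move=> /locally_holo_bounded[r [M [r0 H]]].
have M0 : 0 <= M.
  by have [_] := H X ltac:(by rewrite subrr nr0); apply: le_trans; exact: nr_ge0.
have v1 : 0 < nr v + 1 by rewrite ltr_wpDl // nr_ge0.
(* Makes every step v / s n shorter than r/8, a quarter of the radius r/2 at which [taylor1_bound]
   is applied. *)
have [N0 HN0] : exists N : nat, (nr v + 1) * 8 / r < N%:R.
  by exists (Num.bound ((nr v + 1) * 8 / r)); apply: archi_boundP; rewrite divr_ge0 ?mulr_ge0 ?ltW.
pose s n : R := ((n + N0).+1)%:R.
have s0 n : 0 < s n by rewrite ltr0n.
have sv n : nr v / s n < r / 8.
  rewrite ltr_pdivrMr // mulrC -ltr_pdivrMr; last lra.
  apply: (@lt_trans _ _ N0%:R); last by rewrite ltr_nat; lia.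
  apply: le_lt_trans _ HN0; rewrite invf_div mulrA ler_wpM2r ?invr_ge0 ?(ltW r0) //.
  by rewrite ler_wpM2r // lerDl.
pose u n Y : C^o := (s n)%:K *: (f (Y + (s n)^-1%:K *: v) - f Y).
have r2 : 0 < r / 2 by lra.
have K2 : 0 <= 2048 * M / (r / 2) ^+ 2.
  exact: (divr_ge0 (mulr_ge0 (ler0n _ _) M0) (exprn_ge0 _ (ltW r2))).
have close n Y : nr (Y - X) < r / 4 -> nr (u n Y - 'D_v f Y) <= 2048 * M / (r / 2) ^+ 2 * nr v ^+ 2 / s n.
  move=> hY.
  have dY : differentiable f Y by have [] := H Y ltac:(lra).
  have HY : holo_bounded f Y (r / 2) M by apply: holo_bounded_sub H _; lra.
  rewrite (deriveE v dY).
  have sK : (s n)%:K * (s n)^-1%:K = 1 :> C.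
    by rewrite -rmorphM /= divff ?rmorph1 // gt_eqF.
  have nw : nr ((s n)^-1%:K *: v) = nr v / s n.
    by rewrite nrZ nrC ger0_norm ?invr_ge0 ?(ltW (s0 n)) // mulrC.
  have -> : u n Y - 'd f Y v = (s n)%:K *: (f (Y + (s n)^-1%:K *: v) - f Y - 'd f Y ((s n)^-1%:K *: v)).
    by rewrite linearZ [in RHS]scalerBr scalerA sK scale1r.
  rewrite nrZ nrC (ger0_norm (ltW (s0 n))).
  have hw : nr ((s n)^-1%:K *: v) < r / 2 / 4.
    by rewrite nw (_ : r / 2 / 4 = r / 8); [exact: sv | field].
  have := taylor1_bound r2 HY hw.
  rewrite nw => h; apply: le_trans (ler_wpM2l (ltW (s0 n)) h) _.
  move: (s n) (s0 n) => q q0.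
  by rewrite le_eqVlt; apply/orP; left; apply/eqP; field; rewrite !gt_eqF.
have dB n Y : nr (Y - X) < r / 4 -> differentiable (u n) Y.
  move=> hY.
  have hY' : nr (Y + (s n)^-1%:K *: v - X) < r.
    rewrite addrAC; apply: le_lt_trans (nrD _ _) _.
    rewrite nrZ nrC ger0_norm ?invr_ge0 ?(ltW (s0 n)) // mulrC.
    apply: lt_trans (ltrD hY (sv n)) _; lra.
  have d1 : differentiable f Y by have [] := H Y ltac:(lra).
  have d2 : differentiable f (Y + (s n)^-1%:K *: v) by have [] := H _ hY'.
  have d3 : differentiable (fun Z => Z + (s n)^-1%:K *: v) Y.
    by apply: (@differentiableD _ _ _ (id : E -> E)) => //; exact: differentiable_cst.
  have d4 : differentiable (f \o (fun Z => Z + (s n)^-1%:K *: v)) Y by exact: differentiable_comp.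
  by apply: (@differentiableZ _ _ _ ((f \o (fun Z => Z + (s n)^-1%:K *: v)) \- f)); exact: differentiableB.
pose B := 64 * M / r * nr v + 2048 * M / (r / 2) ^+ 2 * nr v ^+ 2.
apply: (@differentiable_uniform_limit u _ X (r / 4) B); first lra.
  move=> n Y hY; split; first exact: dB.
  have dY : differentiable f Y by have [] := H Y ltac:(lra).
  have HY : holo_bounded f Y (r / 2) M by apply: holo_bounded_sub H _; lra.
  rewrite -[u n Y](subrK ('D_v f Y)) addrC.
  apply: le_trans (nrD _ _) _; apply: lerD.
    rewrite (deriveE v dY); apply: le_trans (frechet_cauchy _ HY v) _; first lra.
    rewrite ler_wpM2r ?nr_ge0 //.
    rewrite (_ : 16 * M / (r / 2) = 32 * M / r); last by field; rewrite gt_eqF.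
    by rewrite ler_wpM2r ?invr_ge0 ?(ltW r0) // ler_wpM2r // ler_nat.
  apply: le_trans (close n Y hY) _.
  rewrite ler_pdivrMr //; apply: ler_peMr; last by rewrite ler1n.
  by rewrite mulr_ge0 // exprn_ge0 // nr_ge0.
move=> e e0.
pose T := 2048 * M / (r / 2) ^+ 2 * nr v ^+ 2.
have T0 : 0 <= T by rewrite mulr_ge0 // exprn_ge0 // nr_ge0.
have [N HN] : exists N : nat, T / e < N%:R.
  by exists (Num.bound (T / e)); apply: archi_boundP; rewrite divr_ge0 // ltW.
exists N => n Nn Y hY; apply: le_trans (close n Y hY) _.
rewrite ler_pdivrMr // -[X in X <= _]/T -ler_pdivrMl // [_ * T]mulrC.
apply: le_trans (ltW HN) _; rewrite ler_nat.
by apply: leqW; apply: leq_trans Nn _; exact: leq_addr.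
Qed.

End Weierstrass.
End UniformLimits.

(** * Meromorphic functions *)

Lemma near_eq_differentiable (K : numFieldType) (V W : normedModType K) (f g : V -> W) x :
  (\near x, f x = g x) -> differentiable f x -> differentiable g x.
Proof.
move=> fg df; have [dfc /eqaddoP dfo] := (diff_locallyP _ _).1 df.
have go : g \o shift x = cst (g x) + 'd f x +o_ (0 : V) id.
  apply/eqaddoP => e e0; have := dfo e e0.
  have fg0 : \forall y \near (0 : V), f (y + x) = g (y + x).
    by move: fg; rewrite (near_shift 0 x) /=; apply: filterS => y /=; rewrite subr0.
  apply: filterS2 fg0 => y /= fgy.
  by rewrite /= -[(g \o _ - _) y]/(g (y + x) - (g x + 'd f x y)) -fgy -(nbhs_singleton fg).
by apply/diff_locallyP; rewrite (diff_unique dfc go).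
Qed.

Section Meromorphic.
Variables (R : realType) (g : nat).
Local Notation C := (R[i]).
Local Notation M := (MC R g).
Local Notation SP := (@siegel_pre R g).
Implicit Types (U V : set M) (f F : M -> C^o).

Lemma near_neq0 f X : differentiable f X -> f X != 0 -> \forall Y \near X, f Y != 0.
Proof.
move=> /differentiable_continuous fc f0.
exact: (cvgr_neq0 (f X) fc f0).
Qed.

(** Near a point where [q1] is nonzero it stays nonzero, and the density for [q2] can be used inside
    that neighbourhood. *)
Lemma dense_neq0 V (q1 q2 : M -> C^o) : open V ->
  (forall X, V X -> differentiable q1 X) ->
  V `<=` closure (V `&` [set X | q1 X != 0]) ->
  V `<=` closure (V `&` [set X | q2 X != 0]) ->
  V `<=` closure (V `&` [set X | q1 X * q2 X != 0]).
Proof.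
move=> Vo dq1 d1 d2 X VX B BX.
have VBX : nbhs X (B `&` V) by apply: filterI => //; exact: open_nbhs_nbhs.
have [Y [[VY /= q1Y] /= BY]] := d1 X VX _ (nbhs_interior VBX).
have q1n : nbhs Y [set Z | q1 Z != 0].
  exact: near_neq0 (dq1 Y VY) q1Y.
have [Z [[VZ /= q2Z] [[BZ _] /= q1Z]]] := d2 Y VY _ (filterI BY q1n).
by exists Z; split=> //; split=> //=; rewrite mulf_neq0.
Qed.

Lemma closure_restrict V V' (P : set M) : open V' -> V' `<=` V ->
  V `<=` closure (V `&` P) -> V' `<=` closure (V' `&` P).
Proof.
move=> V'o sV d X V'X B BX.
have [Y [[VY PY] [BY V'Y]]] := d X (sV _ V'X) (B `&` V')
   (filterI BX (open_nbhs_nbhs (conj V'o V'X))).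
by exists Y.
Qed.

Lemma merom_on2 U f1 f2 : merom_on U f1 -> merom_on U f2 ->
  forall X0, U X0 -> exists V (h1 q1 h2 q2 : M -> C^o),
  [/\ open V /\ V X0, V `<=` U,
   forall X, V X -> [/\ differentiable h1 X, differentiable q1 X, differentiable h2 X & differentiable q2 X],
   V `<=` closure (V `&` [set X | q1 X * q2 X != 0]) &
   forall X, V X -> q1 X * q2 X != 0 -> [/\ q1 X != 0, q2 X != 0, f1 X = h1 X / q1 X & f2 X = h2 X / q2 X]].
Proof.
move=> m1 m2 X0 UX0.
have [V1 [h1 [q1 [[Vo1 VX1] s1 d1 c1 e1]]]] := m1 X0 UX0.
have [V2 [h2 [q2 [[Vo2 VX2] s2 d2 c2 e2]]]] := m2 X0 UX0.
have Vo12 : open (V1 `&` V2) by exact: openI.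
exists (V1 `&` V2), h1, q1, h2, q2; split=> //.
- by move=> X [/s1].
- by move=> X [/d1[? ?] /d2[? ?]].
- apply: dense_neq0 => //.
  + by move=> X [/d1[? ?] _].
  + by apply: closure_restrict c1 => // X [].
  + by apply: closure_restrict c2 => // X [].
- move=> X [X1 X2]; rewrite mulf_eq0 negb_or => /andP[n1 n2].
  by split=> //; [exact: e1 | exact: e2].
Qed.

Lemma merom_onD U f1 f2 : merom_on U f1 -> merom_on U f2 ->
  merom_on U (fun X => f1 X + f2 X : C^o).
Proof.
move=> m1 m2 X0 UX0.
have [V [h1 [q1 [h2 [q2 [Vo sV dV cV eV]]]]]] := merom_on2 m1 m2 UX0.
exists V, (fun X => h1 X * q2 X + h2 X * q1 X : C^o), (fun X => q1 X * q2 X : C^o).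
split; [exact: Vo | exact: sV | | exact: cV |].
  move=> X /dV[a b c d]; split; last exact: (differentiableM b d).
  exact: (differentiableD (differentiableM a d) (differentiableM c b)).
move=> X VX; move=> /(eV X VX)[n1 n2 -> ->].
by move: (h1 X) (h2 X) (q1 X) (q2 X) n1 n2 => a b c d n1 n2; field; rewrite n1 n2.
Qed.

Lemma merom_onM U f1 f2 : merom_on U f1 -> merom_on U f2 ->
  merom_on U (fun X => f1 X * f2 X : C^o).
Proof.
move=> m1 m2 X0 UX0.
have [V [h1 [q1 [h2 [q2 [Vo sV dV cV eV]]]]]] := merom_on2 m1 m2 UX0.
exists V, (fun X => h1 X * h2 X : C^o), (fun X => q1 X * q2 X : C^o).
split; [exact: Vo | exact: sV | | exact: cV |].
  by move=> X /dV[a b c d]; split; [exact: (differentiableM a c) | exact: (differentiableM b d)].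
move=> X VX; move=> /(eV X VX)[n1 n2 -> ->].
by move: (h1 X) (h2 X) (q1 X) (q2 X) n1 n2 => a b c d n1 n2; field; rewrite n1 n2.
Qed.

Lemma merom_onZ U (a : C) f : merom_on U f -> merom_on U (fun X => a * f X : C^o).
Proof.
move=> m X0 UX0; have [V [h [q [[Vo VX] sV dV cV eV]]]] := m X0 UX0.
exists V, (fun X => a * h X : C^o), q; split; [by split | exact: sV | | exact: cV |].
  by move=> X /dV[dh dq]; split; [exact: (differentiableZ a dh) | exact: dq].
by move=> X VX' qX; rewrite (eV X VX' qX) mulrA.
Qed.

(** [f0] lends its neighbourhoods to the empty sum, which is treated as [0 * f0]; [U] itself is not
    assumed open. *)
Lemma merom_on_sum U f0 (I : Type) (r : seq I) (P : pred I) (f : I -> M -> C^o) :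
  merom_on U f0 -> (forall i, P i -> merom_on U (f i)) ->
  merom_on U (fun X => \sum_(i <- r | P i) f i X : C^o).
Proof.
move=> m0 mf; elim: r => [|i r IH].
  suff -> : (fun X => \sum_(i <- [::] | P i) f i X : C^o) = (fun X => 0 * f0 X : C^o).
    exact: merom_onZ.
  by apply/funext => X; rewrite big_nil mul0r.
rewrite (_ : (fun X => \sum_(i <- i :: r | P i) f i X : C^o) =
   if P i then (fun X => f i X + \sum_(i <- r | P i) f i X : C^o) else (fun X => \sum_(i <- r | P i) f i X : C^o)).
  by case: ifP => Pi //; apply: merom_onD => //; exact: mf.
by apply/funext => X; rewrite big_cons; case: ifP.
Qed.

Lemma nbhs_quotient V (h q f : M -> C^o) X : open V -> V X -> q X != 0 ->
  (forall X, V X -> differentiable h X /\ differentiable q X) ->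
  (forall X, V X -> q X != 0 -> f X = h X / q X) ->
  \forall Y \near X, V Y /\ q Y != 0 /\ h Y / q Y = f Y.
Proof.
move=> Vo VX qX dV eV.
have qn : nbhs X [set Z | q Z != 0].
  exact: near_neq0 (dV X VX).2 qX.
have Vn : nbhs X V by exact: open_nbhs_nbhs.
by apply: filterS2 Vn qn => Y VY qY; rewrite eV.
Qed.

Lemma quotient_near V (h q f : M -> C^o) X : open V -> V X -> q X != 0 ->
  (forall X, V X -> differentiable h X /\ differentiable q X) ->
  (forall X, V X -> q X != 0 -> f X = h X / q X) ->
  differentiable f X /\
  forall v, 'D_v f X = (q X * 'D_v h X - h X * 'D_v q X) / (q X * q X).
Proof.
move=> Vo VX qX dV eV.
have [dh dq] := dV X VX.
have nE : \forall Y \near X, (h * (fun Z => (q Z)^-1)) Y = f Y.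
  by apply: filterS (nbhs_quotient Vo VX qX dV eV) => Y [_ [_]].
have diV : differentiable (fun Z => (q Z)^-1 : C^o) X by exact: differentiableV.
split; first by apply: near_eq_differentiable nE _; exact: differentiableM.
move=> v; rewrite -(near_eq_derive v nE) deriveM; [|exact: diff_derivable..].
rewrite deriveV //; last exact: diff_derivable.
rewrite -![_ *: (_ : C^o)]/(_ * _).
move: (h X) (q X) qX ('D_v h X) ('D_v q X); clear=> a b n c d.
by field.
Qed.

(** The quotient rule with denominator q^2. Its numerator contains the derivatives of [h] and [q],
    and this is where [differentiable_derive] enters. *)
Lemma merom_on_derive U f v : merom_on U f -> merom_on U (fun X => 'D_v f X : C^o).
Proof.
move=> m X0 UX0; have [V [h [q [[Vo VX] sV dV cV eV]]]] := m X0 UX0.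
have dd k : (forall X, V X -> differentiable k X) ->
    forall X, V X -> differentiable (fun Y => 'D_v k Y : C^o) X.
  move=> dk X VX'; apply: differentiable_derive.
  by apply: filterS (open_nbhs_nbhs (conj Vo VX')).
exists V, (fun X => q X * 'D_v h X - h X * 'D_v q X : C^o), (fun X => q X * q X : C^o).
split; [by split | exact: sV | | |].
- move=> X VX'; have [dh dq] := dV X VX'.
  have dDh : differentiable (fun Y => 'D_v h Y : C^o) X by exact: (dd h (fun Y VY => (dV Y VY).1) X VX').
  have dDq : differentiable (fun Y => 'D_v q Y : C^o) X by exact: (dd q (fun Y VY => (dV Y VY).2) X VX').
  split; last exact: (differentiableM dq dq).
  exact: (differentiableB (differentiableM dq dDh) (differentiableM dh dDq)).
- exact: (dense_neq0 Vo (fun Y VY => (dV Y VY).2) cV cV).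
- move=> X VX' /=; rewrite mulf_eq0 orbb => qX.
  by have [_ ->] := quotient_near Vo VX' qX dV eV.
Qed.

(* [ae_siegel P] is convertible to [generic (fun X => P (symmx X))]. *)
Definition generic (P : set M) := exists U : set M,
  [/\ open U, U `<=` SP, SP `<=` closure U & U `<=` P].

Lemma genericS (P Q : set M) : P `<=` Q -> generic P -> generic Q.
Proof. by move=> PQ [U [? ? ? UP]]; exists U; split=> // X /UP/PQ. Qed.

Lemma genericI (P Q : set M) : generic P -> generic Q -> generic (P `&` Q).
Proof.
move=> [U [Uo sU cU UP]] [V [Vo sV cV VP]]; exists (U `&` V); split.
- exact: openI.
- by move=> X [/sU].
- move=> X sX B BX.
  have [Y [UY BY]] := cU X sX _ (nbhs_interior BX).
  have [Z [VZ [BZ UZ]]] := cV Y (sU _ UY) _ (filterI BY (open_nbhs_nbhs (conj Uo UY))).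
  by exists Z.
- by move=> X [/UP ? /VP].
Qed.

(** The witnessing set is open, so a generic identity holds around each of its points and may be
    differentiated there. *)
Lemma generic_near (P : set M) : generic P -> generic (fun X => \forall Y \near X, P Y).
Proof.
move=> [U [Uo sU cU UP]]; exists U; split=> // X UX.
by apply: filterS UP _; exact: open_nbhs_nbhs.
Qed.

Lemma generic_pre (P : set M) : generic P -> generic (fun X => SP X).
Proof. by move=> [U [Uo sU cU UP]]; exists U. Qed.

(** [Q] takes care of an empty index type. *)
Lemma generic_forall (I : finType) (P : I -> set M) (Q : set M) : generic Q ->
  (forall i, generic (P i)) -> generic (fun X => forall i, P i X).
Proof.
move=> gQ gP.
suff H (s : seq I) : generic (fun X => forall i, i \in s -> P i X).
  by apply: genericS (H (enum I)) => X HX i; apply: HX; rewrite mem_enum.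
elim: s => [|i s IH]; first by apply: genericS gQ => X _ i.
apply: genericS (genericI (gP i) IH) => X [Pi Ps] j.
by rewrite inE => /orP[/eqP ->|/Ps].
Qed.

Lemma generic_differentiable f : merom_on SP f ->
  generic (fun X => differentiable f X).
Proof.
move=> m; exists (interior [set X : M | SP X /\ differentiable f X]); split.
- exact: open_interior.
- by move=> X /interior_subset[].
- move=> X0 sX0 B BX.
  have [V [h [q [[Vo VX] sV dV cV eV]]]] := m X0 sX0.
  have [Y [[VY /= qY] BY]] := cV X0 VX B BX.
  exists Y; split=> //.
  apply: filterS (nbhs_quotient Vo VY qY dV eV) => Z [VZ [qZ _]].
  by split; [exact: sV | have [] := quotient_near Vo VZ qZ dV eV].
- by move=> X /interior_subset[].
Qed.

End Meromorphic.

(** * The symplectic action *)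

Section MatrixDeterminantLemma.

(** The determinant of the block matrix with rows (1, y) and (-x, 1) is computed twice, clearing [y]
    by a column operation and then by a row operation. *)
Lemma det_one_add_rank1 (K : comNzRingType) n (x : 'cV[K]_n) (y : 'rV[K]_n) :
  \det (1%:M + x *m y) = 1 + (y *m x) 0 0.
Proof.
have E1 : block_mx (1%:M : 'M[K]_1) y (- x) 1%:M *m block_mx 1%:M (- y) 0 1%:M
   = block_mx (1%:M : 'M[K]_1) 0 (- x) (1%:M + x *m y).
  rewrite mulmx_block !mulmx1 !mulmx0 !mul1mx !addr0 addNr.
  by rewrite mulNmx mulmxN opprK addrC.
have E2 : block_mx (1%:M : 'M[K]_1) (- y) 0 1%:M *m block_mx (1%:M : 'M[K]_1) y (- x) 1%:M
   = block_mx (1%:M + y *m x) 0 (- x) 1%:M.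
  rewrite mulmx_block !mulmx1 !mul0mx !mul1mx !add0r subrr.
  by rewrite mulNmx mulmxN opprK.
have := congr1 determinant E1; rewrite det_mulmx det_ublock !det1 !mulr1 det_lblock det1 mul1r => <-.
have := congr1 determinant E2; rewrite det_mulmx det_ublock !det1 !mul1r det_lblock det1 mulr1 => ->.
by rewrite det_mx11 !mxE eqxx.
Qed.

End MatrixDeterminantLemma.

Section SymplecticAction.
Variables (R : realType) (g : nat).
Local Notation C := (R[i]).
Implicit Types (M : 'M[int]_(g + g)) (Z V X : 'M[C]_g).

Definition num M Z : 'M[C]_g := blkA R M *m Z + blkB R M.

Lemma Jsympl_sq : Jsympl g *m Jsympl g = - 1%:M.
Proof.
rewrite /Jsympl mulmx_block !mul0mx !mulmx0 !mul1mx !mulmx1 !add0r !addr0.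
by rewrite (scalar_mx_block g g 1) opp_block_mx !oppr0.
Qed.

(** The relation says that - J M^T J is a left inverse of [M]; as a square matrix it is also a right
    inverse. *)
Lemma symplectic_tr M : symplectic M -> symplectic M^T.
Proof.
rewrite /symplectic trmxK => sM.
have H1 : (- Jsympl g *m M^T *m Jsympl g) *m M = 1%:M.
  by rewrite -!mulmxA mulNmx (mulmxA M^T) sM Jsympl_sq opprK.
have H2 := mulmx1C H1.
have : M *m (- Jsympl g *m M^T *m Jsympl g) *m Jsympl g = Jsympl g by rewrite H2 mul1mx.
by rewrite -!mulmxA Jsympl_sq !mulNmx !mulmxN mulmx1 opprK.
Qed.

Lemma symplectic_int M : symplectic M ->
  [/\ (ulsubmx M)^T *m dlsubmx M = (dlsubmx M)^T *m ulsubmx M,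
      (ursubmx M)^T *m drsubmx M = (drsubmx M)^T *m ursubmx M &
      (ulsubmx M)^T *m drsubmx M - (dlsubmx M)^T *m ursubmx M = 1%:M].
Proof.
rewrite /symplectic -{1 2}(submxK M) /Jsympl tr_block_mx !mulmx_block.
rewrite !mulmx0 !mulmx1 !add0r !addr0 !mulmxN !mulmx1 => /eq_block_mx[e1 e2 e3 e4].
split.
- by apply/eqP; rewrite -subr_eq0 addrC -mulNmx e1.
- by apply/eqP; rewrite -subr_eq0 addrC -mulNmx e4.
- by rewrite addrC -mulNmx e2.
Qed.

Lemma toCM m (X Y : 'M[int]_m) : toC R (X *m Y) = toC R X *m toC R Y.
Proof. exact: (map_mxM (intmul 1 : {rmorphism int -> C})). Qed.

Lemma toC_tr m (X : 'M[int]_m) : toC R X^T = (toC R X)^T.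
Proof. by rewrite /toC map_trmx. Qed.

Lemma toCB m (X Y : 'M[int]_m) : toC R (X - Y) = toC R X - toC R Y.
Proof. exact: (map_mxB (intmul 1 : {rmorphism int -> C})). Qed.

Lemma toC1 m : toC R (1%:M : 'M[int]_m) = 1%:M.
Proof. exact: (map_mx1 (intmul 1 : {rmorphism int -> C})). Qed.

Lemma symplectic_blk M : symplectic M ->
  [/\ (blkA R M)^T *m blkC R M = (blkC R M)^T *m blkA R M,
      (blkB R M)^T *m blkD R M = (blkD R M)^T *m blkB R M &
      (blkA R M)^T *m blkD R M - (blkC R M)^T *m blkB R M = 1%:M].
Proof.
move=> /symplectic_int[e1 e2 e3]; rewrite /blkA /blkB /blkC /blkD -!toC_tr -!toCM.
by rewrite -toCB e3 toC1 e1 e2.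
Qed.

Lemma symplectic_blk_CD M : symplectic M ->
  blkC R M *m (blkD R M)^T = blkD R M *m (blkC R M)^T.
Proof.
move=> /symplectic_tr/symplectic_int[_ e2 _].
rewrite -trmx_dlsub -trmx_drsub !trmxK in e2.
by rewrite /blkC /blkD -!toC_tr -!toCM e2.
Qed.

(** [num] and [Jfac] are the blocks of M (Z; 1), so this is invariance of the symplectic form on
    (Z1; 1) and (Z2; 1), up to sign. Taking Z1 to be the conjugate of Z2 gives invertibility of the
    factor, Z1 = Z2 symmetry of the image, and Z2 = Z1 + D the displacement formula. *)
Lemma symplectic_form M Z1 Z2 : symplectic M ->
  (Jfac M Z1)^T *m num M Z2 - (num M Z1)^T *m Jfac M Z2 = Z2 - Z1^T.
Proof.
move=> /symplectic_blk[]; rewrite /Jfac /num.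
move: (blkA R M) (blkB R M) (blkC R M) (blkD R M) => a b c d e1 e2 e3.
have e3' : d^T *m a - b^T *m c = 1%:M.
  by rewrite -[1%:M]trmx1 -e3 linearB /= !trmx_mul !trmxK.
rewrite !linearD /= !trmx_mul ?mulmxDl ?mulmxDr !mulmxA.
rewrite -[Z2 in RHS]mul1mx -e3' -[Z1^T in RHS]mulmx1 -e3 mulmxBl mulmxBr !mulmxA.
have e1' : Z1^T *m a^T *m c = Z1^T *m c^T *m a by rewrite -!mulmxA e1.
rewrite e1' e2.
move: (_ *m a *m Z2) (Z1^T *m c^T *m b) (d^T *m a *m Z2) (d^T *m b) (Z1^T *m a^T *m d) (b^T *m c *m Z2).
move=> x1 x2 x3 x4 x5 x6; apply/matrixP => i j; rewrite !mxE; ring.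
Qed.

Lemma siegel_sym Z : siegel Z -> Z^T = Z. Proof. by case. Qed.

Local Notation conjM := (map_mx (@complex.conjc R)).

Lemma siegel_conj_sub Z : siegel Z -> Z - (conjM Z)^T = (2 * 'i%C) *: map_mx (real_complex R) (Defs.ImM Z).
Proof.
move=> sZ; rewrite map_trmx (siegel_sym sZ).
apply/matrixP => i j; rewrite !mxE; case: (Z i j) => a b /=.
by apply/eqP; rewrite eq_complex /=; apply/andP; split; apply/eqP; ring.
Qed.

Lemma conj_toC m (X : 'M[int]_m) : conjM (toC R X) = toC R X.
Proof.
apply/matrixP => i j; rewrite !mxE -(rmorph_int (real_complex R)).
exact: conjc_real.
Qed.

Lemma conj_Jfac M Z : conjM (Jfac M Z) = Jfac M (conjM Z).
Proof. by rewrite /Jfac map_mxD map_mxM /= !conj_toC. Qed.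

(** For a kernel vector v, sandwiching [symplectic_form] at (conj Z, Z) between conj v and v kills
    the left side and leaves 2 i v* (Im Z) v = 0. The real part of v* (Im Z) v is the sum of the
    values of Im Z at the real and imaginary parts of v. *)
Lemma Jfac_unit M Z : symplectic M -> siegel Z -> Jfac M Z \in unitmx.
Proof.
move=> sM sZ; have [sZt [Yt Ypos]] := sZ.
rewrite -unitmx_tr unitmxE unitfE; apply/det0P => -[v v0 vQ].
have Qv : Jfac M Z *m v^T = 0 by rewrite -[_ *m _]trmxK trmx_mul trmxK vQ trmx0.
have vQc : conjM v *m (Jfac M (conjM Z))^T = 0.
  by rewrite -conj_Jfac map_trmx -map_mxM vQ map_mx0.
have := congr1 (fun X => conjM v *m X *m v^T) (symplectic_form (conjM Z) Z sM).
rewrite mulmxBr mulmxBl !mulmxA vQc !mul0mx -(mulmxA _ (Jfac M Z)) Qv mulmx0 subr0.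
rewrite siegel_conj_sub // -scalemxAr -scalemxAl => /esym/eqP.
have i0 : 'i%C != 0 :> C by rewrite eq_complex /= oner_eq0 andbF.
rewrite scaler_eq0 mulf_eq0 pnatr_eq0 (negPf i0) /= => /eqP.
pose a : 'cV[R]_g := \col_i complex.Re (v 0 i).
pose b : 'cV[R]_g := \col_i complex.Im (v 0 i).
have vE : v^T = map_mx (real_complex R) a + 'i%C *: map_mx (real_complex R) b.
  by apply/matrixP => i j; rewrite !mxE !ord1 [LHS]complexE.
have vcE : conjM v = (map_mx (real_complex R) a)^T - 'i%C *: (map_mx (real_complex R) b)^T.
  apply/matrixP => i j; rewrite !mxE !ord1; case: (v 0 j) => x y /=.
  by apply/eqP; rewrite eq_complex /=; apply/andP; split; apply/eqP; ring.
move=> /(congr1 (fun X : 'M[C]_1 => complex.Re (X 0 0))).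
rewrite vE vcE mulmxBl mulmxBl !mulmxDr -!scalemxAl -!scalemxAr !map_trmx -!map_mxM.
have nn (x : 'cV[R]_g) : 0 <= (x^T *m Defs.ImM Z *m x) 0 0.
  have [->|/Ypos/ltW//] := eqVneq x 0; by rewrite mulmx0 mxE.
have := nn a; have := nn b; have := Ypos a; have := Ypos b.
move: (a^T *m _ *m a) (b^T *m _ *m b) (a^T *m _ *m b) (b^T *m _ *m a) => aa bb ab ba.
rewrite !mxE /= => pb pa hb ha H.
have {}H : aa 0 0 + bb 0 0 = 0 by rewrite -[RHS]H; ring.
have a0 : a = 0 by apply/eqP/negPn/negP => /pa; lra.
have b0 : b = 0 by apply/eqP/negPn/negP => /pb; lra.
by move: v0; rewrite -[v]trmxK vE a0 b0 !map_mx0 scaler0 addr0 trmx0 eqxx.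
Qed.

Lemma num_Jfac_sym M Z : symplectic M -> Z^T = Z ->
  (Jfac M Z)^T *m num M Z = (num M Z)^T *m Jfac M Z.
Proof.
by move=> sM sZ; apply/eqP; rewrite -subr_eq0 symplectic_form // sZ subrr.
Qed.

Lemma sp_act_tr M Z : symplectic M -> Z^T = Z -> Jfac M Z \in unitmx ->
  (Jfac M Z)^T *m sp_act M Z = (num M Z)^T.
Proof.
move=> sM sZ uQ; rewrite /sp_act -/(num M Z) mulmxA num_Jfac_sym // -mulmxA.
by rewrite mulmxV // mulmx1.
Qed.

Lemma sp_act_sym M Z : symplectic M -> Z^T = Z -> Jfac M Z \in unitmx ->
  (sp_act M Z)^T = sp_act M Z.
Proof.
move=> sM sZ uQ; have uQt : (Jfac M Z)^T \in unitmx by rewrite unitmx_tr.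
rewrite /sp_act -/(num M Z) trmx_mul trmx_inv -(sp_act_tr sM sZ uQ) mulmxA mulVmx //.
by rewrite mul1mx.
Qed.

(** The finite form of the differential of the action: M.Z' - M.Z = J(Z)^-T (Z' - Z) J(Z')^-1. *)
Lemma sp_act_shift M Z D V : symplectic M -> Z^T = Z ->
  Jfac M Z \in unitmx -> Jfac M (Z + D) \in unitmx ->
  D = (Jfac M Z)^T *m V *m Jfac M (Z + D) ->
  sp_act M (Z + D) = sp_act M Z + V.
Proof.
move=> sM sZ uQ uQ' DE.
have uQt : (Jfac M Z)^T \in unitmx by rewrite unitmx_tr.
have H : (Jfac M Z)^T *m num M (Z + D) = (Jfac M Z)^T *m ((sp_act M Z + V) *m Jfac M (Z + D)).
  have := symplectic_form Z (Z + D) sM; rewrite sZ addrAC subrr add0r => /eqP.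
  rewrite subr_eq => /eqP ->.
  by rewrite mulmxA (mulmxDr _ (sp_act M Z) V) (mulmxDl _ (_ *m V)) -DE sp_act_tr // addrC.
have {}H : num M (Z + D) = (sp_act M Z + V) *m Jfac M (Z + D).
  by rewrite -[LHS](mulKmx uQt) H mulKmx.
by rewrite {1}/sp_act -/(num M _) H mulmxK.
Qed.

Lemma JfacD M Z D : Jfac M (Z + D) = Jfac M Z + blkC R M *m D.
Proof. by rewrite /Jfac mulmxDr addrAC. Qed.

Lemma blkC_Jfac_sym M Z : symplectic M -> Z^T = Z ->
  blkC R M *m (Jfac M Z)^T = Jfac M Z *m (blkC R M)^T.
Proof.
move=> sM sZ; rewrite /Jfac linearD /= trmx_mul sZ mulmxDr mulmxDl.
by rewrite symplectic_blk_CD // !mulmxA.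
Qed.

(** Since J(Z + D) = Q + C D, the condition on [D] in [sp_act_shift] is linear: (1 - Q^T V C) D =
    Q^T V Q. This is its coefficient matrix, and [sp_shift] is the solution. *)
Definition shift_denom M Z V : 'M[C]_g := 1%:M - (Jfac M Z)^T *m V *m blkC R M.

Definition sp_shift M Z V : 'M[C]_g :=
  invmx (shift_denom M Z V) *m ((Jfac M Z)^T *m V *m Jfac M Z).

Lemma sp_shiftP M Z V : shift_denom M Z V \in unitmx ->
  sp_shift M Z V = (Jfac M Z)^T *m V *m Jfac M (Z + sp_shift M Z V).
Proof.
move=> uN; rewrite JfacD mulmxDr mulmxA.
have : shift_denom M Z V *m sp_shift M Z V = (Jfac M Z)^T *m V *m Jfac M Z.
  by rewrite /sp_shift mulKVmx.
by rewrite {1}/shift_denom mulmxBl mul1mx => <-; rewrite subrK.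
Qed.

(** With N the coefficient matrix and S = Q^T V Q, the identity C Q^T = Q C^T yields N S = S N^T,
    hence N^-1 S is symmetric. *)
Lemma sp_shift_sym M Z V : symplectic M -> Z^T = Z -> V^T = V ->
  Jfac M Z \in unitmx -> shift_denom M Z V \in unitmx ->
  (sp_shift M Z V)^T = sp_shift M Z V.
Proof.
move=> sM sZ sV uQ uN.
set N := shift_denom M Z V in uN *; set Q := Jfac M Z in uQ *.
have uNt : N^T \in unitmx by rewrite unitmx_tr.
have VV : (Q^T *m V *m Q)^T = Q^T *m V *m Q by rewrite !trmx_mul trmxK sV mulmxA.
have e : Q^T *m V *m blkC R M *m (Q^T *m V *m Q) = Q^T *m V *m Q *m (Q^T *m V *m blkC R M)^T.
  rewrite !trmx_mul trmxK sV -!mulmxA (mulmxA (blkC R M)) (blkC_Jfac_sym sM sZ).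
  by rewrite -!mulmxA.
have H : N *m (Q^T *m V *m Q) = (Q^T *m V *m Q) *m N^T.
  by rewrite /N /shift_denom -/Q mulmxBl mul1mx e linearB /= trmx1 mulmxBr mulmx1.
rewrite /sp_shift -/N -/Q trmx_mul trmx_inv VV.
by rewrite -[LHS](mulKmx uN) (mulmxA N _ (invmx N^T)) H -mulmxA mulmxV // mulmx1.
Qed.

(** * The action along a rank-one line *)

Section RankOne.
Variables (M : 'M[int]_(g + g)) (Z : 'M[C]_g) (u : 'cV[C]_g).
Hypotheses (sM : symplectic M) (sZ : Z^T = Z) (uQ : Jfac M Z \in unitmx).
Let Q := Jfac M Z.
Let w := Q^T *m u.
Let s := (u^T *m blkC R M *m w) 0 0.

Lemma Jfac_rank1_tr t : (Jfac M (Z + t *: (w *m w^T)))^T *m u = (1 + t * s) *: w.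
Proof.
rewrite JfacD linearD /= mulmxDl -/Q -/w scalerDl scale1r; congr (_ + _).
rewrite -scalemxAr linearZ /= -scalemxAl -scalerA; congr (_ *: _).
have sE : w^T *m ((blkC R M)^T *m u) = s%:M.
  rewrite -[LHS]trmxK [X in X^T]mx11_scalar tr_scalar_mx; congr (_%:M).
  by rewrite /s !trmx_mul !trmxK.
rewrite (trmx_mul _ (w *m w^T)) (trmx_mul w) trmxK -!mulmxA sE mul_mx_scalar.
by rewrite -scalemxAr.
Qed.

(** Factoring out [Q] leaves a rank-one perturbation of 1, and w^T Q^-1 = u^T turns its determinant
    into 1 + t s. *)
Lemma Jfac_rank1_det t : \det (Jfac M (Z + t *: (w *m w^T))) = \det Q * (1 + t * s).
Proof.
rewrite JfacD -/Q.
have -> : Q + blkC R M *m (t *: (w *m w^T)) = Q *m (1%:M + (t *: (invmx Q *m blkC R M *m w)) *m w^T).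
  move: (w) => v; rewrite mulmxDr mulmx1 -scalemxAl -!scalemxAr; congr (_ + _ *: _).
  by rewrite -!mulmxA mulKVmx.
rewrite det_mulmx det_one_add_rank1 -scalemxAr mxE; congr (_ * (1 + _ * _)).
have wT : w^T = u^T *m Q by rewrite /w trmx_mul trmxK.
by rewrite wT /s; move: (w) => v; rewrite -!mulmxA mulKVmx.
Qed.

Lemma sp_act_rank1 (t l : C) : t = l * (1 + t * s) ->
  Jfac M (Z + t *: (w *m w^T)) \in unitmx ->
  sp_act M (Z + t *: (w *m w^T)) = sp_act M Z + l *: (u *m u^T).
Proof.
move=> tl uQ'; apply: sp_act_shift => //.
have E : u^T *m Jfac M (Z + t *: (w *m w^T)) = (1 + t * s) *: w^T.
  by rewrite -[LHS]trmxK trmx_mul trmxK Jfac_rank1_tr linearZ.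
have F : Q^T *m (u *m u^T) *m Jfac M (Z + t *: (w *m w^T))
    = w *m (u^T *m Jfac M (Z + t *: (w *m w^T))).
  by move: (Jfac M (Z + _)) => K; rewrite /w !mulmxA.
by rewrite -scalemxAr -scalemxAl F E -scalemxAr scalerA -tl.
Qed.

End RankOne.
End SymplecticAction.

(** * Differentiation along symmetric matrices *)

Section Symmx.
Variables (R : realType) (g : nat).
Local Notation C := (R[i]).
Local Notation M := (MC R g).
Implicit Types (X Y Z V : 'M[C]_g).

Lemma symmx_id Z : Z^T = Z -> symmx Z = Z.
Proof.
move=> sZ; apply/matrixP => i j; rewrite mxE; case: ifP => // _.
by rewrite -[in LHS]sZ mxE.
Qed.

Lemma symmx_sym X : (symmx X)^T = symmx X.
Proof.
apply/matrixP => i j; rewrite !mxE; case: (ltngtP i j) => // ij.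
by rewrite (val_inj ij).
Qed.

Lemma symmxD X Y : symmx (X + Y) = symmx X + symmx Y.
Proof. by apply/matrixP => i j; rewrite !mxE; case: ifP. Qed.

Lemma symmxDr X V : V^T = V -> symmx (X + V) = symmx X + V.
Proof. by move=> sV; rewrite symmxD (symmx_id sV). Qed.

Lemma symmxZ (a : C) X : symmx (a *: X) = a *: symmx X.
Proof. by apply/matrixP => i j; rewrite !mxE; case: ifP. Qed.

(** A line through [symmx X] in a symmetric direction is the [symmx] image of a parallel line
    through [X], so the two difference quotients coincide and values of [f] off the symmetric
    matrices never enter. *)
Lemma derive_symmx (f : 'M[C]_g -> C) X V : V^T = V ->
  'D_(V : M) (fun Y : M => (f Y : C^o)) (symmx X) = 'D_(V : M) (fun Y : M => (f (symmx Y) : C^o)) (X : M).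
Proof.
move=> sV; rewrite /derive; set k := fun _ => _; set h := fun _ => _.
suff -> : k = h by [].
by apply/funext => l; rewrite /k /h /= symmxD symmxZ (symmx_id sV).
Qed.

Definition sym_delta (i j : 'I_g) : 'M[C]_g := 2^-1 *: (delta_mx i j + delta_mx j i).

Lemma sym_delta_sym i j : (sym_delta i j)^T = sym_delta i j.
Proof. by rewrite /sym_delta linearZ /= linearD /= !trmx_delta addrC. Qed.

Lemma sum_sym_delta (u : 'cV[C]_g) :
  \sum_i \sum_j (u i 0 * u j 0) *: sym_delta i j = u *m u^T.
Proof.
have E : \sum_i \sum_j (u i 0 * u j 0) *: delta_mx i j = u *m u^T.
  rewrite [RHS]matrix_sum_delta; apply: eq_bigr => i _; apply: eq_bigr => j _.
  by rewrite !mxE big_ord1 !mxE.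
have E' : \sum_i \sum_j (u i 0 * u j 0) *: delta_mx j i = u *m u^T.
  by rewrite exchange_big /= -E; apply: eq_bigr => i _; apply: eq_bigr => j _; rewrite mulrC.
transitivity (2^-1 *: (\sum_i \sum_j (u i 0 * u j 0) *: delta_mx i j
    + \sum_i \sum_j (u i 0 * u j 0) *: delta_mx j i) : 'M[C]_g).
  rewrite -big_split scaler_sumr; apply: eq_bigr => i _.
  rewrite -big_split scaler_sumr; apply: eq_bigr => j _ /=.
  by rewrite /sym_delta -scalerDr !scalerA mulrC.
rewrite E E' scalerDr -scalerDl (_ : 2^-1 + 2^-1 = 1 :> C) ?scale1r //.
by field.
Qed.

(** Linearity in the direction, which Frechet differentiability provides, turns the double sum of
    the raw derivative into a single derivative along u u^T. *)
Lemma derive_sum_sym_delta (f : M -> C^o) (X : M) (u : 'cV[C]_g) : differentiable f X ->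
  \sum_i \sum_j (u i 0 * u j 0) * 'D_(sym_delta i j : M) f X = 'D_(u *m u^T : M) f X.
Proof.
move=> df; rewrite -sum_sym_delta.
apply: etrans _ (esym (deriveE _ df)); rewrite linear_sum; apply: eq_bigr => i _.
rewrite linear_sum; apply: eq_bigr => j _.
by apply: etrans _ (esym (linearZ _ _)); congr (_ * _); exact: deriveE.
Qed.

Lemma derive_symmx_sum (f : 'M[C]_g -> C) (X : M) (u : 'cV[C]_g) :
  differentiable (fun Y : M => (f (symmx Y) : C^o)) X ->
  \sum_i \sum_j (u i 0 * u j 0) * 'D_(sym_delta i j : M) (fun Y : M => (f Y : C^o)) (symmx X)
  = 'D_(u *m u^T : M) (fun Y : M => (f (symmx Y) : C^o)) X.
Proof.
move=> df; apply: etrans _ (derive_sum_sym_delta u df).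
apply: eq_bigr => i _; apply: eq_bigr => j _.
by rewrite derive_symmx // sym_delta_sym.
Qed.

End Symmx.

Section Coordinates.
Variables (R : realType) (A : falgType R[i]).
Local Notation C := (R[i]).

Lemma AcoordD l (v w : A) : Acoord l (v + w) = Acoord l v + Acoord l w.
Proof. exact: linearD. Qed.

Lemma AcoordN l (v : A) : Acoord l (- v) = - Acoord l v.
Proof. exact: linearN. Qed.

Lemma AcoordZ l a (v : A) : Acoord l (a *: v) = a * Acoord l v.
Proof. exact: linearZ. Qed.

Lemma Acoord_sum l (I : Type) (r : seq I) (P : pred I) (F : I -> A) :
  Acoord l (\sum_(i <- r | P i) F i) = \sum_(i <- r | P i) Acoord l (F i).
Proof. exact: linear_sum. Qed.

Lemma Acoord_inj (v w : A) : (forall l, Acoord l v = Acoord l w) -> v = w.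
Proof.
move=> H; rewrite (coord_vbasis (memvf v)) (coord_vbasis (memvf w)).
by apply: eq_bigr => l _; congr (_ *: _); exact: H.
Qed.

Lemma Acoord_dder g l (f : 'M[C]_g -> A) (Z V : 'M[C]_g) :
  Acoord l (dder f Z V) = 'D_(V : MC R g) (fun X : MC R g => (Acoord l (f X) : C^o)) Z.
Proof.
rewrite /dder /Acoord.
under eq_bigr do rewrite (tnth_nth 0).
by rewrite coord_sum_free // (basis_free (vbasisP _)).
Qed.

End Coordinates.

(** * Entrywise differentiation of matrix-valued maps *)

Section Entrywise.
Variables (R : realType) (E : normedModType R[i]).
Local Notation C := (R[i]).
Implicit Types (x : E).

Lemma differentiable_bigsum (I : Type) (r : seq I) (P : pred I) (V : normedModType C)
    (f : I -> E -> V) x : (forall i, P i -> differentiable (f i) x) ->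
  differentiable (fun y => \sum_(i <- r | P i) f i y) x.
Proof.
move=> df; elim: r => [|i r IH].
  rewrite (_ : (fun y => _) = cst 0); first exact: differentiable_cst.
  by apply/funext => y; rewrite big_nil.
case Pi : (P i); last first.
  by rewrite (_ : (fun y => _) = (fun y => \sum_(i <- r | P i) f i y)) //; apply/funext => y; rewrite big_cons Pi.
rewrite (_ : (fun y => _) = (fun y => f i y + \sum_(i <- r | P i) f i y)).
  exact: (differentiableD (df i Pi) IH).
by apply/funext => y; rewrite big_cons Pi.
Qed.

Lemma differentiable_bigprod (I : Type) (r : seq I) (P : pred I)
    (f : I -> E -> C^o) x : (forall i, P i -> differentiable (f i) x) ->
  differentiable (fun y => \prod_(i <- r | P i) f i y : C^o) x.
Proof.
move=> df; elim: r => [|i r IH].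
  rewrite (_ : (fun y => _) = cst (1 : C^o)); first exact: differentiable_cst.
  by apply/funext => y; rewrite big_nil.
case Pi : (P i); last first.
  by rewrite (_ : (fun y => _) = (fun y => \prod_(i <- r | P i) f i y : C^o)) //; apply/funext => y; rewrite big_cons Pi.
rewrite (_ : (fun y => _) = (fun y => f i y * \prod_(i <- r | P i) f i y : C^o)).
  exact: (differentiableM (df i Pi) IH).
by apply/funext => y; rewrite big_cons Pi.
Qed.

Lemma differentiable_expr (f : E -> C^o) n x : differentiable f x ->
  differentiable (fun y => f y ^+ n : C^o) x.
Proof.
move=> df; rewrite (_ : (fun y => _) = (fun y => \prod_(i < n) f y : C^o)).
  by apply: differentiable_bigprod => i _; exact: df.
by apply/funext => y; rewrite prodr_const card_ord.
Qed.

Lemma differentiable_exprz (f : E -> C^o) (k : int) x : differentiable f x -> f x != 0 ->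
  differentiable (fun y => f y ^ k : C^o) x.
Proof.
move=> df f0; case: k => n; first exact: differentiable_expr.
apply: (@differentiableV _ _ (fun y => f y ^+ n.+1 : C^o)); last by rewrite expf_neq0.
exact: differentiable_expr.
Qed.

(** Working entry by entry reduces matrix products, determinants and adjugates to sums and products
    of scalar functions. *)
Definition entries_diff p q (f : E -> 'M[C]_(p, q)) x :=
  forall i j, differentiable (fun y => f y i j : C^o) x.

Lemma entries_diff_cst p q (B : 'M[C]_(p, q)) x : entries_diff (fun=> B) x.
Proof. by move=> i j; exact: differentiable_cst. Qed.

Lemma entries_diffD p q (f h : E -> 'M[C]_(p, q)) x :
  entries_diff f x -> entries_diff h x -> entries_diff (fun y => f y + h y) x.
Proof.
move=> df dh i j; rewrite (_ : (fun y => _) = (fun y => f y i j + h y i j : C^o)).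
  exact: (differentiableD (df i j) (dh i j)).
by apply/funext => y; rewrite mxE.
Qed.

Lemma entries_diffN p q (f : E -> 'M[C]_(p, q)) x :
  entries_diff f x -> entries_diff (fun y => - f y) x.
Proof.
move=> df i j; rewrite (_ : (fun y => _) = (fun y => - f y i j : C^o)).
  exact: (differentiableN (df i j)).
by apply/funext => y; rewrite mxE.
Qed.

Lemma entries_diffM p q r (f : E -> 'M[C]_(p, q)) (h : E -> 'M[C]_(q, r)) x :
  entries_diff f x -> entries_diff h x -> entries_diff (fun y => f y *m h y) x.
Proof.
move=> df dh i j; rewrite (_ : (fun y => _) = (fun y => \sum_k f y i k * h y k j : C^o)).
  by apply: differentiable_bigsum => k _; exact: (differentiableM (df i k) (dh k j)).
by apply/funext => y; rewrite mxE.
Qed.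

Lemma entries_diffZ p q (a : E -> C^o) (f : E -> 'M[C]_(p, q)) x :
  differentiable a x -> entries_diff f x -> entries_diff (fun y => a y *: f y) x.
Proof.
move=> da df i j; rewrite (_ : (fun y => _) = (fun y => a y * f y i j : C^o)).
  exact: (differentiableM da (df i j)).
by apply/funext => y; rewrite mxE.
Qed.

Lemma entries_diff_tr p q (f : E -> 'M[C]_(p, q)) x :
  entries_diff f x -> entries_diff (fun y => (f y)^T) x.
Proof.
move=> df i j; rewrite (_ : (fun y => _) = (fun y => f y j i : C^o)); first exact: df.
by apply/funext => y; rewrite mxE.
Qed.

Lemma differentiable_det n (f : E -> 'M[C]_n) x :
  entries_diff f x -> differentiable (fun y => \det (f y) : C^o) x.
Proof.
move=> df; apply: differentiable_bigsum => s _.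
have dp : differentiable (fun y => \prod_i f y i (s i) : C^o) x.
  by apply: differentiable_bigprod => i _; exact: df.
exact: (differentiableM (differentiable_cst ((-1) ^+ s : C^o) x) dp).
Qed.

Lemma entries_diff_adj n (f : E -> 'M[C]_n) x :
  entries_diff f x -> entries_diff (fun y => \adj (f y)) x.
Proof.
move=> df i j; rewrite (_ : (fun y => _) = (fun y => cofactor (f y) j i : C^o)); last first.
  by apply/funext => y; rewrite mxE.
have dd : differentiable (fun y => \det (row' j (col' i (f y))) : C^o) x.
  apply: differentiable_det => a b.
  rewrite (_ : (fun y => _) = (fun y => f y (lift j a) (lift i b) : C^o)); first exact: df.
  by apply/funext => y; rewrite !mxE.
exact: (differentiableM (differentiable_cst ((-1) ^+ (j + i) : C^o) x) dd).
Qed.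

Lemma differentiable_entries p q (f : E -> 'M[C]_(p, q)) x :
  entries_diff f x -> differentiable (f : E -> ('M[C]_(p, q) : normedModType C)) x.
Proof.
move=> df; rewrite (_ : f = fun y => \sum_i \sum_j f y i j *: (delta_mx i j : ('M[C]_(p, q) : normedModType C))).
  apply: differentiable_bigsum => i _; apply: differentiable_bigsum => j _.
  exact: (differentiableZl _ (df i j)).
by apply/funext => y; exact: matrix_sum_delta.
Qed.

End Entrywise.

(** * Expansions in monomials *)

Section Monomials.
Variables (R : realType) (g m : nat).
Local Notation C := (R[i]).
Implicit Types (al : {ffun 'I_g -> 'I_m.+1}) (u : 'cV[C]_g).

Lemma monomialZ (a : C) u al : is_mono al -> monomial (a *: u) al = a ^+ m * monomial u al.
Proof.
move=> /eqP am; have <- : \prod_i a ^+ (al i) = a ^+ m by rewrite prodrXr am.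
rewrite /monomial -big_split /=.
by apply: eq_bigr => i _; rewrite mxE exprMn.
Qed.

(** The exponent of u_i u_j u^al. [inord] never truncates, because each exponent is at most m +
    2. *)
Definition mono_raise al (i j : 'I_g) : {ffun 'I_g -> 'I_m.+3} :=
  [ffun k => inord (al k + (k == i) + (k == j))].

Lemma mono_raiseE al i j k : mono_raise al i j k = (al k + (k == i) + (k == j))%N :> nat.
Proof. by rewrite ffunE inordK //; have := ltn_ord (al k); case: (k == i); case: (k == j); lia. Qed.

Lemma mono_raise_mono al i j : is_mono al -> @is_mono g m.+2 (mono_raise al i j).
Proof.
move=> /eqP am; apply/eqP.
under eq_bigr do rewrite mono_raiseE.
have E (k : 'I_g) : (\sum_(l : 'I_g) (l == k) = 1)%N.
  by rewrite (bigD1 k) //= eqxx big1 // => l /negPf ->.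
by rewrite !big_split /= am !E !addn1.
Qed.

Lemma monomial_raise al i j u :
  @monomial R g m.+2 u (mono_raise al i j) = u i 0 * u j 0 * monomial u al.
Proof.
rewrite /monomial.
under eq_bigr do rewrite mono_raiseE !exprD.
have E (k : 'I_g) : \prod_i0 u i0 0 ^+ (i0 == k) = u k 0.
  by rewrite (bigD1 k) //= eqxx expr1 big1 ?mulr1 // => l /negPf ->.
by rewrite !big_split /= !E -mulrA mulrC.
Qed.

End Monomials.

Lemma derive_bigsum (R : realType) (E : normedModType R[i]) (I : Type) (r : seq I) (P : pred I)
    (f : I -> E -> R[i]^o) x v : (forall i, P i -> differentiable (f i) x) ->
  'D_v (fun y => \sum_(i <- r | P i) f i y : R[i]^o) x = \sum_(i <- r | P i) 'D_v (f i) x.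
Proof.
move=> df; elim: r => [|i r IH].
  rewrite big_nil (_ : (fun y => _) = cst (0 : R[i]^o)); first exact: derive_cst.
  by apply/funext => y; rewrite big_nil.
rewrite big_cons; case Pi : (P i); last first.
  by rewrite -IH; congr ('D_v _ x); apply/funext => y; rewrite big_cons Pi.
rewrite -IH -deriveD; last 2 first.
- exact: diff_derivable (df i Pi).
- exact: diff_derivable (differentiable_bigsum _ df).
by congr ('D_v _ x); apply/funext => y; rewrite big_cons Pi.
Qed.

Section Expansion.
Variables (R : realType) (g m : nat) (A : falgType R[i]).
Local Notation C := (R[i]).
Local Notation M := (MC R g).
Variables (Phi : 'M[C]_g -> 'cV[C]_g -> A) (c : {ffun 'I_g -> 'I_m.+1} -> 'M[C]_g -> A).

Definition coef_fun l al (X : M) : C^o := Acoord l (c al (symmx X)).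

Definition expansion_at (Y : M) := [/\ siegel_pre Y,
  forall u, Phi (symmx Y) u = \sum_(al | is_mono al) monomial u al *: c al (symmx Y) &
  forall al l, is_mono al -> differentiable (coef_fun l al) Y].

(** The expansion of [Phi] is only generic; asking for it in a whole neighbourhood allows
    derivatives of [Phi] to be replaced by those of the coefficients. *)
Definition regular (X : M) := \forall Y \near X, expansion_at Y.

Hypothesis cmer : forall al, is_mono al -> merom_siegel_vec (c al).
Hypothesis Phic : ae_siegel (fun Z => forall u, Phi Z u = \sum_(al | is_mono al) monomial u al *: c al Z).

Lemma generic_regular : generic regular.
Proof.
apply: generic_near.
have gS : generic (fun X : M => siegel_pre X) by exact: generic_pre Phic.
have gd : generic (fun X : M => forall al l, is_mono al -> differentiable (coef_fun l al) X).
  apply: (generic_forall gS) => al; apply: (generic_forall gS) => l.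
  case am : (is_mono al); last by apply: genericS gS.
  by apply: genericS (generic_differentiable (cmer am l)).
apply: genericS (genericI gS (genericI Phic gd)) => X [sX [eX dX]].
by split.
Qed.

Lemma Acoord_expansion l u X : regular X ->
  \forall Y \near X, Acoord l (Phi (symmx Y) u) = \sum_(al | is_mono al) monomial u al * coef_fun l al Y.
Proof.
apply: filterS => Y [_ -> _]; rewrite Acoord_sum.
by apply: eq_bigr => al _; rewrite AcoordZ.
Qed.

Lemma regular_differentiable l al X : regular X -> is_mono al -> differentiable (coef_fun l al) X.
Proof. by move=> /nbhs_singleton[_ _]; apply. Qed.

Lemma differentiable_expansion l u X : regular X ->
  differentiable (fun Y : M => \sum_(al | is_mono al) monomial u al * coef_fun l al Y : C^o) X.
Proof.
move=> rX; apply: differentiable_bigsum => al am.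
exact: (differentiableZ (monomial u al) (regular_differentiable l rX am)).
Qed.

Lemma differentiable_Phi l u X : regular X ->
  differentiable (fun Y : M => Acoord l (Phi (symmx Y) u) : C^o) X.
Proof.
move=> rX; apply: near_eq_differentiable (differentiable_expansion l u rX).
by apply: filterS (Acoord_expansion l u rX) => Y ->.
Qed.

Lemma derive_Phi l u X V : regular X ->
  'D_(V : M) (fun Y : M => Acoord l (Phi (symmx Y) u) : C^o) X
  = \sum_(al | is_mono al) monomial u al * 'D_(V : M) (coef_fun l al) X.
Proof.
move=> rX.
pose S (Y : M) : C^o := \sum_(al | is_mono al) monomial u al * coef_fun l al Y.
apply: etrans (@near_eq_derive _ M C^o _ S X V (Acoord_expansion l u rX)) _.
rewrite derive_bigsum => [|al am]; last first.
  exact: (differentiableZ (monomial u al) (regular_differentiable l rX am)).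
apply: eq_bigr => al am.
exact: (deriveZ (monomial u al) (diff_derivable (regular_differentiable l rX am))).
Qed.

End Expansion.

(** * Meromorphic coefficients of the raised form *)

Section RaisedExpansion.
Variables (R : realType) (g m : nat) (A : falgType R[i]).
Local Notation C := (R[i]).
Local Notation M := (MC R g).
Variables (Phi : 'M[C]_g -> 'cV[C]_g -> A) (c : {ffun 'I_g -> 'I_m.+1} -> 'M[C]_g -> A).
Variables (Amat : 'M[C]_g -> 'M[C]_g) (e : C) (k : int).
Hypothesis hg : (1 <= g)%N.
Hypothesis cmer : forall al, is_mono al -> merom_siegel_vec (c al).
Hypothesis Phic : ae_siegel (fun Z => forall u, Phi Z u = \sum_(al | is_mono al) monomial u al *: c al Z).
Hypothesis Amer : merom_siegel_mx Amat.

Definition DA_scalar : C := (k%:~R + m%:R) / (2 * e).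

Definition raised_term i j al (Z : 'M[C]_g) : A :=
  (two_pi_i R)^-1 *: dder (c al) Z (sym_delta R i j) - (DA_scalar * Amat Z i j) *: c al Z.

(** Collects all triples (i, j, al) whose product u_i u_j u^al is the monomial u^be. *)
Definition raised_coef (be : {ffun 'I_g -> 'I_m.+3}) (Z : 'M[C]_g) : A :=
  \sum_i \sum_j \sum_(al | is_mono al && (mono_raise al i j == be)) raised_term i j al Z.

Lemma merom_raised be : merom_siegel_vec (raised_coef be).
Proof.
move=> l; rewrite /merom_siegel.
have -> : (fun X : M => Acoord l (raised_coef be (symmx X)) : C^o) =
  (fun X : M => \sum_i \sum_j \sum_(al | is_mono al && (mono_raise al i j == be))
    ((two_pi_i R)^-1 * 'D_(sym_delta R i j : M) (coef_fun c l al) X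
     + (- DA_scalar) * (Amat (symmx X) i j * coef_fun c l al X)) : C^o).
  apply/funext => X; rewrite /raised_coef Acoord_sum; apply: eq_bigr => i _.
  rewrite Acoord_sum; apply: eq_bigr => j _; rewrite Acoord_sum; apply: eq_bigr => al _.
  rewrite /raised_term AcoordD AcoordN !AcoordZ Acoord_dder derive_symmx ?sym_delta_sym //.
  by rewrite mulNr mulrA.
(* [hg] provides an index, so an entry of [Amat] can play the auxiliary function of
   [merom_on_sum]. *)
pose f0 (X : M) : C^o := Amat (symmx X) (Ordinal hg) (Ordinal hg).
have mf0 : merom_on (@siegel_pre R g) f0 by exact: Amer.
apply: (merom_on_sum _ mf0) => i _; apply: (merom_on_sum _ mf0) => j _.
apply: (merom_on_sum _ mf0) => al /andP[am _].
have mc : merom_on (@siegel_pre R g) (coef_fun c l al) by exact: (cmer am l).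
apply: merom_onD; apply: merom_onZ; first exact: merom_on_derive.
by apply: merom_onM => //; exact: Amer.
Qed.

Lemma quadratic_form_sum (B : 'M[C]_g) (u : 'cV[C]_g) :
  (u^T *m B *m u) 0 0 = \sum_i \sum_j u i 0 * u j 0 * B i j.
Proof.
rewrite mxE exchange_big /=; apply: eq_bigr => j _.
rewrite mxE mulr_suml; apply: eq_bigr => i _.
by rewrite mxE mulrAC mulrC mulrA.
Qed.

Lemma Acoord_DA l (Z : 'M[C]_g) (u : 'cV[C]_g) :
  Acoord l (DA Amat e k m Phi Z u) =
  (two_pi_i R)^-1 * (\sum_i \sum_j u i 0 * u j 0 *
     'D_(sym_delta R i j : M) (fun Y : M => Acoord l (Phi Y u) : C^o) Z)
  - DA_scalar * (u^T *m Amat Z *m u) 0 0 * Acoord l (Phi Z u).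
Proof.
rewrite /DA /Draw AcoordD AcoordN AcoordZ; congr (_ - _).
rewrite Acoord_sum mulr_sumr; apply: eq_bigr => i _.
rewrite Acoord_sum mulr_sumr; apply: eq_bigr => j _.
by rewrite AcoordZ /Dij AcoordZ Acoord_dder mulrCA.
Qed.

Lemma DA_expansion X u : regular Phi c X ->
  DA Amat e k m Phi (symmx X) u = \sum_(be | @is_mono g m.+2 be) monomial u be *: raised_coef be (symmx X).
Proof.
move=> rX; apply: Acoord_inj => l; rewrite Acoord_DA.
pose T i j al : C := (two_pi_i R)^-1 * 'D_(sym_delta R i j : M) (coef_fun c l al) X
     - DA_scalar * (Amat (symmx X) i j * coef_fun c l al X).
transitivity (\sum_i \sum_j \sum_(al | is_mono al) u i 0 * u j 0 * monomial u al * T i j al).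
  rewrite quadratic_form_sum (nbhs_singleton (Acoord_expansion l u rX)).
  set S := \sum_(al | _) _; rewrite -[X in _ - X]mulrA mulr_suml !mulr_sumr -sumrB.
  apply: eq_bigr => i _; rewrite mulr_suml !mulr_sumr -sumrB; apply: eq_bigr => j _.
  rewrite derive_symmx ?sym_delta_sym // (derive_Phi l u (sym_delta R i j) rX) /S.
  rewrite !mulr_sumr -sumrB; apply: eq_bigr => al am.
  by rewrite /T; ring.
rewrite Acoord_sum.
transitivity (\sum_i \sum_j \sum_(be | @is_mono g m.+2 be) \sum_(al | is_mono al && (mono_raise al i j == be))
    monomial u be * T i j al).
  apply: eq_bigr => i _; apply: eq_bigr => j _.
  rewrite (partition_big (fun al => mono_raise al i j) (@is_mono g m.+2)) /=; last first.
    by move=> al; exact: mono_raise_mono.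
  apply: eq_bigr => be _; apply: eq_bigr => al /andP[_ /eqP <-].
  by rewrite monomial_raise.
under eq_bigr do rewrite exchange_big /=.
rewrite exchange_big /=; apply: eq_bigr => be _.
rewrite AcoordZ /raised_coef Acoord_sum mulr_sumr; apply: eq_bigr => i _.
rewrite Acoord_sum mulr_sumr; apply: eq_bigr => j _.
rewrite Acoord_sum mulr_sumr; apply: eq_bigr => al _.
rewrite /raised_term AcoordD AcoordN !AcoordZ Acoord_dder derive_symmx ?sym_delta_sym //.
by rewrite /T mulrA.
Qed.

Lemma merom_sym_DA : merom_sym m.+2 (DA Amat e k m Phi).
Proof.
exists raised_coef; split; first by move=> be _; exact: merom_raised.
apply: (@genericS R g _ _ _ (generic_regular cmer Phic)) => X rX u.
exact: DA_expansion.
Qed.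

End RaisedExpansion.

(** * The transformation law *)

Section OneVariable.
Variable R : realType.
Local Notation C := (R[i]).

Lemma derive_comp (U V W : normedModType C) (f : V -> W) (h : U -> V) x v :
  differentiable h x -> differentiable f (h x) ->
  'D_v (f \o h) x = 'D_('D_v h x) f (h x).
Proof.
move=> dh df.
have dfh : differentiable (f \o h) x by exact: (differentiable_comp dh df).
apply: etrans (deriveE v dfh) _.
apply: etrans (congr1 (fun F => F v) (diff_comp dh df)) _.
apply: etrans _ (esym (deriveE _ df)).
exact: (congr1 ('d f (h x)) (esym (deriveE v dh))).
Qed.

Lemma derive_expr_at1 (q : C^o -> C^o) x s n : derivable q x 1 -> 'D_1 q x = s -> q x = 1 ->
  derivable (fun t => q t ^+ n : C^o) x 1 /\ 'D_1 (fun t => q t ^+ n : C^o) x = n%:R * s.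
Proof.
move=> dq Dq q1; elim: n => [|n [IH1 IH2]].
  by split; [exact: derivable_cst | rewrite mul0r; exact: derive_cst].
have E : (fun t => q t ^+ n.+1 : C^o) = q * (fun t => q t ^+ n : C^o).
  by apply/funext => t; rewrite exprS.
split; first by rewrite E; exact: (derivableM dq IH1).
rewrite E (deriveM dq IH1) IH2 Dq q1 expr1n -![_ *: (_ : C^o)]/(_ * _) !mul1r.
by rewrite -natr1 mulrDl mul1r.
Qed.

Lemma derive_exprz_at1 (q : C^o -> C^o) x s (k : int) : derivable q x 1 -> 'D_1 q x = s -> q x = 1 ->
  derivable (fun t => q t ^ k : C^o) x 1 /\ 'D_1 (fun t => q t ^ k : C^o) x = k%:~R * s.
Proof.
move=> dq Dq q1; case: k => n; first exact: derive_expr_at1.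
have [d1 d2] := derive_expr_at1 n.+1 dq Dq q1.
have E : (fun t => q t ^ Negz n : C^o) = (fun t => (q t ^+ n.+1)^-1 : C^o) by [].
have f1 : q x ^+ n.+1 = 1 by rewrite q1 expr1n.
have -> : (Negz n)%:~R * s = - (n.+1%:R * s) by rewrite NegzE rmorphN mulNr.
rewrite E; pose f t : C^o := q t ^+ n.+1; rewrite -/f in d1 d2.
have {}f1 : f x = 1 by [].
have -> : (fun t => (q t ^+ n.+1)^-1 : C^o) = (fun t => (f t)^-1 : C^o) by [].
clearbody f; clear E.
have n0 : f x != 0 by rewrite f1 oner_neq0.
split; first exact: (derivableV n0 d1).
by rewrite (deriveV n0 d1) d2 f1 -![_ *: (_ : C^o)]/(_ * _) expr1n invr1 mulN1r.
Qed.

End OneVariable.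

Section Transformation.
Variables (R : realType) (g m : nat) (A : falgType R[i]).
Local Notation C := (R[i]).
Local Notation MM := (MC R g).
Variables (Phi : 'M[C]_g -> 'cV[C]_g -> A) (c : {ffun 'I_g -> 'I_m.+1} -> 'M[C]_g -> A).
Variables (k : int) (M : 'M[int]_(g + g)).
Hypothesis sM : symplectic M.

Definition transforms_at (Y : MM) := forall u,
  Phi (sp_act M (symmx Y)) u =
    (\det (Jfac M (symmx Y))) ^ k *: Phi (symmx Y) ((Jfac M (symmx Y))^T *m u).

Variable X : MM.
Hypothesis rX : regular Phi c X.
Hypothesis tX : \forall Y \near X, transforms_at Y.
Let Z : 'M[C]_g := symmx X.
Let Q := Jfac M Z.
Let W : 'M[C]_g := sp_act M Z.
Let Psi l u (Y : MM) : C^o := Acoord l (Phi (symmx Y) u).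

Let sZ : Z^T = Z. Proof. exact: symmx_sym. Qed.
Let uQ : Q \in unitmx.
Proof. by apply: Jfac_unit => //; have [] := nbhs_singleton rX. Qed.
Let detQ : \det Q != 0. Proof. by rewrite -unitfE -unitmxE. Qed.
Let sW : W^T = W. Proof. exact: sp_act_sym. Qed.

Let Nden (Y : MM) : 'M[C]_g := shift_denom M Z (symmx Y - W).
(** [sp_shift] with the inverse written as adjugate over determinant, a form open to entrywise
    differentiation; the two agree wherever [Nden] is invertible, in particular near [W]. *)
Let Dsp (Y : MM) : 'M[C]_g :=
  (\det (Nden Y))^-1 *: (\adj (Nden Y) *m (Q^T *m (symmx Y - W) *m Q)).

Let entries_shift : entries_diff (fun Y : MM => symmx Y - W) W.
Proof.
apply: entries_diffD; last exact: entries_diff_cst.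
move=> i j; rewrite (_ : (fun y => _) = (fun y : MM => (if (i <= j)%N then y i j else y j i) : C^o)).
  by case: (i <= j)%N; exact: differentiable_coord.
by apply/funext => Y; rewrite mxE.
Qed.

Let entries_Nden : entries_diff Nden W.
Proof.
apply: entries_diffD; first exact: entries_diff_cst.
apply/entries_diffN/entries_diffM; last exact: entries_diff_cst.
by apply: entries_diffM; first exact: entries_diff_cst.
Qed.

Let shiftW : symmx W - W = 0. Proof. by rewrite symmx_id // subrr. Qed.

Let NdenW : Nden W = 1%:M.
Proof. by rewrite /Nden shiftW /shift_denom mulmx0 mul0mx subr0. Qed.

Let DspW : Dsp W = 0.
Proof. by rewrite /Dsp shiftW mulmx0 mul0mx mulmx0 scaler0. Qed.

Let entries_Dsp : entries_diff Dsp W.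
Proof.
have dd : differentiable (fun Y : MM => \det (Nden Y) : C^o) (W : MM) by exact: differentiable_det.
have n0 : (fun Y : MM => \det (Nden Y) : C^o) W != 0 by rewrite NdenW det1 oner_neq0.
apply: entries_diffZ; first exact: (differentiableV dd n0).
apply: entries_diffM; first exact: entries_diff_adj.
apply: entries_diffM; last exact: entries_diff_cst.
by apply: entries_diffM; first exact: entries_diff_cst.
Qed.

(* Local inverse of the action: [sp_act M (symmx (Theta Y)) = symmx Y] for Y near W *)
Let Theta (Y : MM) : MM := (X : 'M[C]_g) + Dsp Y.

Let differentiable_Theta : differentiable Theta (W : MM).
Proof.
apply: differentiable_entries; apply: entries_diffD => //; exact: entries_diff_cst.
Qed.

Let ThetaW : Theta W = X. Proof. by rewrite /Theta DspW addr0. Qed.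

Let near_Theta (P : set MM) : nbhs X P -> \forall Y \near (W : MM), P (Theta Y).
Proof. by rewrite -{1}ThetaW; exact: (differentiable_continuous differentiable_Theta). Qed.

(** The right side of the law at [Theta Y], written through the coefficients near [X]: each factor
    is differentiable at [W], from which the same is deduced for [Psi]. *)
Let Psi_pullback l u (Y : MM) : C^o := (\det (Jfac M (Z + Dsp Y))) ^ k *
  \sum_(al | is_mono al) monomial ((Jfac M (Z + Dsp Y))^T *m u) al * coef_fun c l al (Theta Y).

Let Psi_pullbackE l u : \forall Y \near (W : MM), Psi_pullback l u Y = Psi l u Y.
Proof.
have dd : differentiable (fun Y : MM => \det (Nden Y) : C^o) (W : MM) by exact: differentiable_det.
have n0 : (fun Y : MM => \det (Nden Y) : C^o) W != 0 by rewrite NdenW det1 oner_neq0.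
near=> Y.
have uN : Nden Y \in unitmx by rewrite unitmxE unitfE; near: Y; exact: (near_neq0 dd n0).
have [sTh exTh _] : expansion_at Phi c (Theta Y) by near: Y; exact: near_Theta.
have trTh : transforms_at (Theta Y) by near: Y; exact: near_Theta.
have sV : (symmx Y - W)^T = symmx Y - W by rewrite linearB /= sW symmx_sym.
have DE : Dsp Y = sp_shift M Z (symmx Y - W).
  by rewrite /Dsp /sp_shift -/(Nden Y) /invmx uN -scalemxAl.
have sD : (Dsp Y)^T = Dsp Y by rewrite DE; exact: (sp_shift_sym sM sZ sV uQ uN).
have ThE : symmx (Theta Y) = Z + Dsp Y by rewrite /Theta symmxDr.
have uJ : Jfac M (Z + Dsp Y) \in unitmx by rewrite -ThE; exact: Jfac_unit.
have DE' : Dsp Y = Q^T *m (symmx Y - W) *m Jfac M (Z + Dsp Y).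
  by rewrite DE; exact: (sp_shiftP uN).
have YE : sp_act M (Z + Dsp Y) = symmx Y.
  by apply: etrans (sp_act_shift sM sZ uQ uJ DE') _; rewrite addrC subrK.
have := trTh u; rewrite ThE YE => PE.
rewrite /Psi PE AcoordZ -ThE exTh Acoord_sum /Psi_pullback -ThE; congr (_ * _).
by apply: eq_bigr => al _; rewrite AcoordZ.
Unshelve. all: by end_near.
Qed.

Lemma differentiable_Psi_act l u : differentiable (Psi l u) (W : MM).
Proof.
apply: near_eq_differentiable (Psi_pullbackE l u) _.
have dJ : entries_diff (fun Y : MM => Jfac M (Z + Dsp Y)) W.
  apply: entries_diffD; last exact: entries_diff_cst.
  apply: entries_diffM; first exact: entries_diff_cst.
  by apply: entries_diffD => //; exact: entries_diff_cst.
(* At [W] the displacement is 0 and the determinant is that of [Q], hence nonzero, so [k] may be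
   negative. *)
have dd : differentiable (fun Y : MM => (\det (Jfac M (Z + Dsp Y))) ^ k : C^o) (W : MM).
  by apply: differentiable_exprz; [exact: differentiable_det | rewrite DspW addr0].
apply: (differentiableM dd); apply: differentiable_bigsum => al am.
have dm : differentiable (fun Y : MM => monomial ((Jfac M (Z + Dsp Y))^T *m u) al : C^o) (W : MM).
  apply: differentiable_bigprod => i _; apply: differentiable_expr.
  have : entries_diff (fun Y : MM => (Jfac M (Z + Dsp Y))^T *m u) W.
    by apply: entries_diffM; [exact: entries_diff_tr | exact: entries_diff_cst].
  exact.
have dc : differentiable (coef_fun c l al) (Theta W).
  by rewrite ThetaW; exact: regular_differentiable rX am.
exact: (differentiableM dm (differentiable_comp differentiable_Theta dc)).
Qed.

Section RankOneDerivative.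
Variables (l : 'I_(\dim (fullv : {vspace A}))) (u : 'cV[C]_g).
Let w := Q^T *m u.
Let s := (u^T *m blkC R M *m w) 0 0.
Let q (t : C^o) : C^o := 1 + t * s.

Let dq : differentiable q 0.
Proof.
apply: (differentiableD (differentiable_cst (1 : C^o) (0 : C^o))).
by apply: (@differentiableZl _ _ _ (id : C^o -> C^o)); exact: ex_diff.
Qed.

Let Dq : derivable q 0 1 /\ 'D_1 q 0 = s.
Proof.
split; first exact: diff_derivable.
have E : q = cst (1 : C^o) + s *: (id : C^o -> C^o).
  by apply/funext => t; rewrite /q mulrC.
have d1 : derivable (cst (1 : C^o)) (0 : C^o) 1 by exact: derivable_cst.
have di : derivable (id : C^o -> C^o) (0 : C^o) 1 by exact: derivable_id.
have d2 : derivable (s *: (id : C^o -> C^o)) (0 : C^o) 1 by apply: derivableZ.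
rewrite E (deriveD d1 d2) derive_cst add0r (deriveZ s di).
by rewrite derive_id -[_ *: (_ : C^o)]/(_ * _) mulr1.
Qed.

Let q0 : q 0 = 1. Proof. by rewrite /q mul0r addr0. Qed.

(* With [t = lam t * (1 + t s)], the point [Z + t w w^T] is mapped to
   [W + lam t u u^T] and the automorphy factor sends [u] to [(1 + t s) w]. *)
Let lam (t : C^o) : C^o := t * (q t)^-1.

Let q00 : q 0 != 0. Proof. by rewrite q0 oner_neq0. Qed.

Let dlam : differentiable lam 0.
Proof.
have di : differentiable (id : C^o -> C^o) (0 : C^o) by exact: ex_diff.
exact: (differentiableM di (differentiableV dq q00)).
Qed.

Let Dlam : 'D_1 lam 0 = 1.
Proof.
have dV : derivable (fun t => (q t)^-1 : C^o) 0 1 by exact: (derivableV q00 Dq.1).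
have di : derivable (id : C^o -> C^o) 0 1 by exact: derivable_id.
have E : lam = (id : C^o -> C^o) * (fun t => (q t)^-1 : C^o) by [].
rewrite E (deriveM di dV) derive_id -![_ *: (_ : C^o)]/(_ * _) mul0r add0r.
by rewrite q0 invr1 mulr1.
Qed.

Let near0_line (P : set MM) : nbhs X P -> \forall t \near (0 : C^o), P (X + t *: (w *m w^T : MM)).
Proof.
have dl : differentiable (fun t : C^o => X + t *: (w *m w^T : MM)) (0 : C^o).
  apply: (differentiableD (differentiable_cst X _)).
  by apply: (@differentiableZl _ _ _ (id : C^o -> C^o)); exact: ex_diff.
by move=> PX; apply: (differentiable_continuous dl); rewrite /= scale0r addr0.
Qed.

Lemma derive_rank1_act :
  'D_(u *m u^T : MM) (Psi l u) (W : MM) =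
  \det Q ^ k * ((k%:~R + m%:R) * s * Psi l w X + 'D_(w *m w^T : MM) (Psi l w) X).
Proof.
pose H (t : C^o) : C^o := Psi l w (X + t *: (w *m w^T : MM)).
pose p (t : C^o) : C^o := q t ^ k * q t ^+ m.
pose Rt (t : C^o) : C^o := \det Q ^ k * (p t * H t).
pose line (a : C^o) : C^o := Psi l u ((W : MM) + a *: (u *m u^T : MM)).
(* The law holds only for t near 0: the displaced point must stay where expansion and law are valid,
   and [q t] must not vanish. *)
have LR : \forall t \near (0 : C^o), (line \o lam) t = Rt t.
  have qn : \forall t \near (0 : C^o), q t != 0.
    apply: (cvgr_neq0 (q 0) (differentiable_continuous dq)).
    by rewrite q0 oner_neq0.
  near=> t.
  have qt0 : q t != 0 by near: t.
  have [sY exY _] : expansion_at Phi c (X + t *: (w *m w^T : MM)) by near: t; exact: near0_line.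
  have trY : transforms_at (X + t *: (w *m w^T : MM)) by near: t; exact: near0_line.
  have sww (a : 'cV[C]_g) b : (b *: (a *m a^T))^T = b *: (a *m a^T).
    by rewrite linearZ /= trmx_mul trmxK.
  have YE : symmx (X + t *: (w *m w^T)) = Z + t *: (w *m w^T) by rewrite symmxDr.
  have uJ : Jfac M (Z + t *: (w *m w^T)) \in unitmx by rewrite -YE; exact: Jfac_unit.
  have tl : t = lam t * (1 + t * s) by rewrite /lam -/(q t) mulfVK.
  have := trY u; rewrite YE (sp_act_rank1 sM sZ uQ tl uJ) -/W => PE.
  rewrite /line /Psi /= symmxDr // (symmx_id sW) PE AcoordZ.
  rewrite Jfac_rank1_tr // Jfac_rank1_det // -/Q -/w -/s -/(q t) expfzMl /Rt /p.
  (* Both sides are expanded in monomials, since it is the expansion that is homogeneous of degree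
     [m] in the vector. *)
  rewrite /H /Psi YE -YE !exY !Acoord_sum -!mulrA; congr (_ * (_ * _)).
  rewrite mulr_sumr; apply: eq_bigr => al am.
  by rewrite !AcoordZ monomialZ // mulrA.
have dPsi := differentiable_Psi_act l u.
have lam0 : lam 0 = 0 by rewrite /lam mul0r.
have daff : differentiable (fun a : C^o => (W : MM) + a *: (u *m u^T : MM)) (0 : C^o).
  apply: (differentiableD (differentiable_cst (W : MM) (0 : C^o))).
  by apply: (@differentiableZl _ _ _ (id : C^o -> C^o)); exact: ex_diff.
have dline : differentiable line (lam 0).
  rewrite lam0; apply: (differentiable_comp daff).
  by rewrite scale0r addr0.
have DL : 'D_1 (line \o lam) 0 = 'D_(u *m u^T : MM) (Psi l u) (W : MM).
  rewrite (@derive_comp R C^o C^o C^o line lam 0 1 dlam dline) Dlam lam0 /line derive_line.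
  by rewrite scale0r addr0.
rewrite -DL (@near_eq_derive _ C^o C^o (line \o lam) Rt 0 1 LR).
have [dp1 Dp1] := derive_exprz_at1 k Dq.1 Dq.2 q0.
have [dp2 Dp2] := derive_expr_at1 m Dq.1 Dq.2 q0.
have pE : p = (fun t => q t ^ k : C^o) * (fun t => q t ^+ m : C^o) by [].
have dp : derivable p 0 1 by rewrite pE; exact: (derivableM dp1 dp2).
have Dp : 'D_1 p 0 = (k%:~R + m%:R) * s.
  rewrite pE (deriveM dp1 dp2) Dp1 Dp2 q0 exp1rz expr1n -![_ *: (_ : C^o)]/(_ * _) !mul1r.
  by rewrite mulrDl addrC.
have dPX : differentiable (Psi l w) X by exact: differentiable_Phi rX.
have dH : derivable H 0 1.
  by apply: derivable_line; rewrite scale0r addr0; exact: diff_derivable.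
have DH : 'D_1 H 0 = 'D_(w *m w^T : MM) (Psi l w) X.
  have X0 : X + (0 : C^o) *: (w *m w^T : MM) = X by rewrite scale0r addr0.
  apply: etrans (derive_line (Psi l w) X (w *m w^T : MM) 0) _.
  exact: (congr1 (fun Y => 'D_(w *m w^T : MM) (Psi l w) Y) X0).
have RE : Rt = (\det Q ^ k) *: (p * H) by [].
have dpH : derivable (p * H) 0 1 by exact: (derivableM dp dH).
rewrite RE (deriveZ _ dpH) (deriveM dp dH) DH Dp -![_ *: (_ : C^o)]/(_ * _).
have -> : p 0 = 1 by rewrite /p q0 exp1rz expr1n mulr1.
have -> : H 0 = Psi l w X by rewrite /H scale0r addr0.
by rewrite mul1r addrC [Psi l w X * _]mulrC.
Unshelve. all: by end_near.
Qed.

End RankOneDerivative.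

Variables (Amat : 'M[C]_g -> 'M[C]_g) (e : C).
Hypothesis e0 : e != 0.
Hypothesis AX : Amat W = Q *m Amat Z *m Q^T + (2 * e / two_pi_i R) *: (Q *m (blkC R M)^T).

Lemma two_pi_i_neq0 : two_pi_i R != 0.
Proof. by rewrite eq_complex /= negb_and mulf_neq0 ?orbT // ?gt_eqF ?pi_gt0. Qed.

Lemma DA_transforms u : DA Amat e k m Phi W u = \det Q ^ k *: DA Amat e k m Phi Z (Q^T *m u).
Proof.
apply: Acoord_inj => l; rewrite AcoordZ !Acoord_DA.
set w := Q^T *m u; pose s := (u^T *m blkC R M *m w) 0 0.
have E1 : \sum_i \sum_j u i 0 * u j 0 *
     'D_(sym_delta R i j : MM) (fun Y : MM => Acoord l (Phi Y u) : C^o) W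
   = 'D_(u *m u^T : MM) (Psi l u) (W : MM).
  have := @derive_symmx_sum R g (fun Y => Acoord l (Phi Y u)) W u (differentiable_Psi_act l u).
  by rewrite [in X in X -> _](symmx_id sW).
have E2 : \sum_i \sum_j w i 0 * w j 0 *
     'D_(sym_delta R i j : MM) (fun Y : MM => Acoord l (Phi Y w) : C^o) Z
   = 'D_(w *m w^T : MM) (Psi l w) X.
  exact: (@derive_symmx_sum R g (fun Y => Acoord l (Phi Y w)) X w (differentiable_Phi l w rX)).
apply: etrans (congr1 (fun x => (two_pi_i R)^-1 * x
  - DA_scalar m e k * (u^T *m Amat W *m u) 0 0 * Acoord l (Phi W u)) E1) _.
apply: etrans _ (esym (congr1 (fun x => \det Q ^ k * ((two_pi_i R)^-1 * x
  - DA_scalar m e k * (w^T *m Amat Z *m w) 0 0 * Acoord l (Phi Z w))) E2)).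
rewrite (derive_rank1_act l u) -/w -/s.
have -> : Acoord l (Phi W u) = \det Q ^ k * Psi l w X.
  by rewrite (nbhs_singleton tX u) AcoordZ.
(* The extra 2 e s / (2 pi i), multiplied by (k + m)/(2 e), is exactly the (k + m) s / (2 pi i)
   coming from the raw derivative. *)
have -> : (u^T *m Amat W *m u) 0 0 = (w^T *m Amat Z *m w) 0 0 + 2 * e / two_pi_i R * s.
  rewrite AX mulmxDr mulmxDl mxE; congr (_ + _).
    by rewrite /w trmx_mul trmxK !mulmxA.
  rewrite -scalemxAr -scalemxAl mxE; congr (_ * _).
  have -> : u^T *m (Q *m (blkC R M)^T) *m u = (u^T *m blkC R M *m w)^T.
    by rewrite /w !trmx_mul !trmxK !mulmxA.
  by rewrite mxE.
rewrite -/(Psi l w X) /DA_scalar.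
move: (Psi l w X) ('D_(_ : MM) (Psi l w) X) ((w^T *m Amat Z *m w) 0 0) s (\det Q ^ k) => ph dph a ss d.
have p0 := two_pi_i_neq0.
by field; rewrite p0 e0.
Qed.

End Transformation.

Theorem mainTheorem17 (R : realType) (g : nat) (hg : (1 <= g)%N)
  (G : set 'M[int]_(g + g)) (hG : congruence_subgroup G)
  (A : falgType (R[i])) (e : R[i]) (he : e != 0)
  (Amat : 'M[R[i]]_g -> 'M[R[i]]_g)
  (hAmer : merom_siegel_mx Amat)
  (hAsym : ae_siegel (fun Z => (Amat Z)^T = Amat Z))
  (hAtr : forall M, G M ->
     ae_siegel (fun Z =>
       Amat (sp_act M Z)
       = Jfac M Z *m Amat Z *m (Jfac M Z)^T
         + (2 * e / two_pi_i R) *: (Jfac M Z *m (blkC R M)^T)))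
  (k : int) (m : nat) (Phi : 'M[R[i]]_g -> 'cV[R[i]]_g -> A) :
  Mkm G k m Phi -> Mkm G k m.+2 (DA Amat e k m Phi).
Proof.
move=> [[c [cm ce]] tr]; split.
  exact: (merom_sym_DA e k hg cm ce hAmer).
move=> M GM; have sM : symplectic M by case: hG => + _ _ _ _; apply.
(* The law of [Phi] gets differentiated and is required near [X]; the law of [Amat] is used only at
   the point. *)
have gX := genericI (generic_regular cm ce) (genericI (generic_near (tr M GM)) (hAtr M GM)).
apply: (genericS _ gX) => X [rX [tX AX]] u.
exact: (DA_transforms sM rX tX he AX u).
Qed.
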